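(* The finite duals $\widehat{S_3}$, $\widehat{A_4}$, and $\widehat{A_5}$ do not have the Frucht property.
   Context: $S_3$ is the symmetric group on three letters, $A_4,A_5$ the alternating groups. For a finite group $\Gamma$, the dual $\widehat\Gamma$ is the finite quantum group with $C(\widehat\Gamma)=\mathrm{C}^*(\Gamma)=\mathbb C\Gamma$ and comultiplication $\Delta(g)=g\otimes g$ for $g\in\Gamma$. A matrix over a $\mathrm{C}^*$-algebra is magic if its entries are projections summing to $1$ on each row and each column. $C(S_N^+)$ is the universal $\mathrm{C}^*$-algebra generated by the entries of an $N\times N$ magic matrix $u$, with comultiplication $\Delta(u_{ij})=\sum_k u_{ik}\otimes u_{kj}$. A finite graph $X$ is a pair $(V,E)$, $|V|=N$, with $E\subset V\times V$ symmetric and irreflexive, and with adjacency matrix $d\in M_N(0,1)$. Its quantum automorphism group $G^+(X)\subset S_N^+$ is the compact quantum group with $C(G^+(X))=C(S_N^+)/\langle du=ud\rangle$ and the induced comultiplication. A compact quantum group $G$ has the Frucht property if there exists a finite graph $X$ such that $G=G^+(X)$, i.e. $G$ and $G^+(X)$ are the same as abstract compact quantum groups (isomorphic via an isomorphism intertwining the comultiplications). *)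

(* Defs.v *)
From HB Require Import structures.
From mathcomp Require Import all_boot all_order all_algebra all_fingroup all_solvable.
From mathcomp Require Import complex.
From mathcomp Require Import ring lra.
From mathcomp Require Import all_classical all_reals topology normedtype sequences.

Set Implicit Arguments.
Unset Strict Implicit.
Unset Printing Implicit Defensive.

Import Order.TTheory GRing.Theory Num.Theory.
Import numFieldNormedType.Exports.

Local Open Scope classical_set_scope.
Local Open Scope ring_scope.

(* Unital complex C*-algebras. The norm is a field of the mixin: NumDomain
   already joins rings with normed Z-modules, so Hierarchy Builder rejects a
   second join of an algebra with NormedModule. Since GRing.Algebra requires
   1 != 0, the zero algebra is excluded; this affects no universal property
   below, as the map to the zero algebra always exists and is unique. *)
HB.mixin Record isCStarAlgebra (R : realType) A & GRing.Algebra R[i] A := {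
  star : A -> A;
  starK : involutive star;
  starD : {morph star : x y / x + y};
  starZ : forall (k : R[i]) (x : A), star (k *: x) = k^* *: star x;
  starM : forall x y : A, star (x * y) = star y * star x;
  cnorm : A -> R;
  cnormD : forall x y : A, cnorm (x + y) <= cnorm x + cnorm y;
  cnormZ : forall (k : R[i]) (x : A),
    cnorm (k *: x) = Normc.normc k * cnorm x;
  cnorm0_eq0 : forall x : A, cnorm x = 0 -> x = 0;
  cnormM : forall x y : A, cnorm (x * y) <= cnorm x * cnorm y;
  cnorm_star : forall x : A, cnorm (star x * x) = cnorm x ^+ 2;
  cnorm_complete : forall u : nat -> A,
    (forall e : R, 0 < e -> \forall m & n \near \oo, cnorm (u m - u n) < e) ->
    exists l : A, cnorm (u n - l) @[n --> \oo] --> (0 : R)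
}.

#[short(type="cstarAlgType")]
HB.structure Definition CStarAlgebra (R : realType) :=
  {A of GRing.Algebra R[i] A & isCStarAlgebra R A}.

Section CStarDefs.
Context {R : realType}.
Implicit Types A B T : cstarAlgType R.

Definition starhom A B (f : A -> B) : Prop :=
  [/\ linear f, monoid_morphism f & forall x, f (star x) = star (f x)].

Definition cclosed A (S : set A) : Prop :=
  forall (u : nat -> A) (l : A), (forall n, S (u n)) ->
    cnorm (u n - l) @[n --> \oo] --> (0 : R) -> S l.

Definition linear_subspace A (S : set A) : Prop :=
  S 0 /\ forall (k : R[i]) x y, S x -> S y -> S (k *: x + y).

Definition sub_cstar A (S : set A) : Prop :=
  [/\ cclosed S, linear_subspace S, S 1,
      forall x y, S x -> S y -> S (x * y) & forall x, S x -> S (star x)].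

Definition cstar_generated A (X : set A) : Prop :=
  forall S : set A, sub_cstar S -> X `<=` S -> S = setT.

Definition closed_ideal A (J : set A) : Prop :=
  [/\ cclosed J, linear_subspace J & forall a b x, J x -> J (a * x * b)].

Definition ideal_of A (X : set A) : set A :=
  [set x | forall J : set A, closed_ideal J -> X `<=` J -> J x].

(* B is A modulo the closed two-sided ideal generated by X. The quotient norm
   is not mentioned: a *-algebra carries at most one C*-norm. *)
Definition is_quotient A B (X : set A) (pi : A -> B) : Prop :=
  [/\ starhom pi, forall y, exists x, pi x = y
    & forall x, pi x = 0 <-> ideal_of X x].

Definition spans_dense A (X : set A) : Prop :=
  forall S : set A, cclosed S -> linear_subspace S -> X `<=` S -> S = setT.

(* T is a completion of the algebraic tensor product of A and B for some
   C*-norm, t a b being the elementary tensor; tens_inj says that the algebraic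
   tensor product embeds in T. *)
Record cstar_tensor A B T (t : A -> B -> T) : Prop := {
  tens_linearl : forall b, linear (t^~ b);
  tens_linearr : forall a, linear (t a);
  tens_inj : forall n (a : 'I_n -> A) (b : 'I_n -> B),
    (forall c : 'I_n -> R[i], \sum_i c i *: a i = 0 -> forall i, c i = 0) ->
    \sum_i t (a i) (b i) = 0 -> forall i, b i = 0;
  tens_one : t 1 1 = 1;
  tens_mul : forall a a' b b', t a b * t a' b' = t (a * a') (b * b');
  tens_star : forall a b, star (t a b) = t (star a) (star b);
  tens_dense : spans_dense [set x | exists a b, x = t a b] }.

(* The minimal (spatial) C*-norm is the least C*-norm on the algebraic tensor
   product. *)
Definition min_tensor A B T (t : A -> B -> T) : Prop :=
  cstar_tensor t /\
  forall T' (t' : A -> B -> T'), cstar_tensor t' ->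
  forall n (a : 'I_n -> A) (b : 'I_n -> B),
    cnorm (\sum_i t (a i) (b i)) <= cnorm (\sum_i t' (a i) (b i)).

(* (Delta (x) id) Delta = (id (x) Delta) Delta, with both threefold tensor
   products identified through the elementary tensors. *)
Definition coassociative A T (t : A -> A -> T) (Delta : A -> T) : Prop :=
  exists (T3 : cstarAlgType R) (tl : T -> A -> T3) (tr : A -> T -> T3)
    (Dl Dr : T -> T3),
    [/\ min_tensor tl /\ min_tensor tr,
        forall a b c, tl (t a b) c = tr a (t b c),
        starhom Dl /\ (forall a b, Dl (t a b) = tl (Delta a) b),
        starhom Dr /\ (forall a b, Dr (t a b) = tr a (Delta b))
      & forall a, Dl (Delta a) = Dr (Delta a)].

End CStarDefs.

(* Compact quantum groups in the sense of Woronowicz; qfun2 is the minimal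
   tensor square of qfun = C(G). *)
Record cqg (R : realType) := CQG {
  qfun : cstarAlgType R;
  qfun2 : cstarAlgType R;
  qtens : qfun -> qfun -> qfun2;
  qcomul : qfun -> qfun2;
  qtensP : min_tensor qtens;
  qcomul_starhom : starhom qcomul;
  qcomulA : coassociative qtens qcomul;
  qcancell : spans_dense [set x | exists a b, x = qtens a 1 * qcomul b];
  qcancelr : spans_dense [set x | exists a b, x = qtens 1 a * qcomul b] }.

Section QuantumGroups.
Context {R : realType}.
Implicit Types G H : cqg R.

Definition comul_morphism G H (f : qfun G -> qfun H) : Prop :=
  starhom f /\
  exists2 f2 : qfun2 G -> qfun2 H, starhom f2 &
    (forall a b, f2 (qtens a b) = qtens (f a) (f b)) /\
    (forall a, f2 (qcomul a) = qcomul (f a)).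

Definition cqg_isom G H : Prop :=
  exists2 f : qfun G -> qfun H, bijective f & comul_morphism f.

Definition projection (A : cstarAlgType R) (p : A) : Prop :=
  p * p = p /\ star p = p.

Definition magic (A : cstarAlgType R) N (u : 'M[A]_N) : Prop :=
  [/\ forall i j, projection (u i j),
      forall i, \sum_j u i j = 1 & forall j, \sum_i u i j = 1].

Definition entries (A : cstarAlgType R) N (u : 'M[A]_N) : set A :=
  [set x | exists i j, x = u i j].

Definition universal_magic (A : cstarAlgType R) N (u : 'M[A]_N) : Prop :=
  [/\ magic u, cstar_generated (entries u)
    & forall (B : cstarAlgType R) (v : 'M[B]_N), magic v ->
        exists2 f : A -> B, starhom f & forall i j, f (u i j) = v i j].

Definition is_quantum_perm N (P : cqg R) (u : 'M[qfun P]_N) : Prop :=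
  universal_magic u /\
  forall i j, qcomul (u i j) = \sum_k qtens (u i k) (u k j).

End QuantumGroups.

Record graph (N : nat) := Graph {
  edge : rel 'I_N;
  edge_sym : symmetric edge;
  edge_irr : irreflexive edge }.

Definition adjmx (A : pzRingType) N (X : graph N) : 'M[A]_N :=
  \matrix_(i, j) (edge X i j)%:R.

Definition is_quantum_aut (R : realType) N (X : graph N) (G : cqg R) : Prop :=
  exists (P : cqg R) (u : 'M[qfun P]_N) (pi : qfun P -> qfun G),
    [/\ is_quantum_perm u,
        is_quotient (entries (adjmx (qfun P) X *m u - u *m adjmx (qfun P) X)) pi
      & comul_morphism pi].

Definition Frucht (R : realType) (G : cqg R) : Prop :=
  exists (N : nat) (X : graph N) (H : cqg R),
    is_quantum_aut X H /\ cqg_isom G H.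

Section GroupAlgebraOps.
Variables (R : realType) (G : finGroupType).

(* C*(G) for a finite group G: functions on G under convolution. *)
Definition galg := {ffun G -> R[i]}.

Implicit Types a b c : galg.

Definition galg_one : galg := [ffun g => (g == 1%g)%:R].
Definition galg_mul a b : galg := [ffun g => \sum_h a h * b (h^-1 * g)%g].
Definition galg_star a : galg := [ffun g => (a g^-1%g)^*].
Definition gdelta (g : G) : galg := [ffun h => (h == g)%:R].

HB.instance Definition _ := GRing.Lmodule.copy galg {ffun G -> R[i]}.

Lemma galg_scaleE (k : R[i]) a g : (k *: a) g = k * a g.
Proof. by rewrite ffunE. Qed.

Lemma galg_addE a b g : (a + b) g = a g + b g.
Proof. by rewrite ffunE. Qed.

Lemma galg_sumE (I : Type) (r : seq I) (P : pred I) (F : I -> galg) g :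
  (\sum_(i <- r | P i) F i) g = \sum_(i <- r | P i) F i g.
Proof.
by apply: (big_morph (fun a : galg => a g)) => [a b|]; rewrite ffunE.
Qed.

Lemma galg_mulA : associative galg_mul.
Proof.
move=> a b c; apply/ffunP => g; rewrite !ffunE.
under eq_bigr do rewrite ffunE mulr_sumr.
under [RHS]eq_bigr do rewrite ffunE mulr_suml.
rewrite [RHS]exchange_big /=; apply: eq_bigr => h _.
rewrite [RHS](reindex_inj (mulgI h)) /=; apply: eq_bigr => k _.
by rewrite mulKg invMg !mulgA mulrA.
Qed.

Lemma galg_mul1 : left_id galg_one galg_mul.
Proof.
move=> a; apply/ffunP => g; rewrite !ffunE (bigD1 1%g) //= big1 => [|h /negPf nh].
  by rewrite !ffunE eqxx mul1r addr0 invg1 mul1g.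
by rewrite ffunE nh mul0r.
Qed.

Lemma galg_mulr1 : right_id galg_one galg_mul.
Proof.
move=> a; apply/ffunP => g; rewrite !ffunE (bigD1 g) //= big1 => [|h nh].
  by rewrite !ffunE mulVg eqxx mulr1 addr0.
rewrite ffunE; case: eqP => [e|]; last by rewrite mulr0.
by move: nh; rewrite -[h]mulg1 -e mulKVg eqxx.
Qed.

Lemma galg_mulDl : left_distributive galg_mul +%R.
Proof.
move=> a b c; apply/ffunP => g; rewrite !ffunE -big_split.
by apply: eq_bigr => h _; rewrite ffunE mulrDl.
Qed.

Lemma galg_mulDr : right_distributive galg_mul +%R.
Proof.
move=> a b c; apply/ffunP => g; rewrite !ffunE -big_split.
by apply: eq_bigr => h _; rewrite ffunE mulrDr.
Qed.

Lemma galg_one_neq0 : galg_one != 0.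
Proof.
by apply/eqP => /ffunP /(_ 1%g); rewrite !ffunE eqxx => /eqP; rewrite oner_eq0.
Qed.

HB.instance Definition _ := GRing.Zmodule_isNzRing.Build galg
  galg_mulA galg_mul1 galg_mulr1 galg_mulDl galg_mulDr galg_one_neq0.

Lemma galg_scaleAl (k : R[i]) a b : k *: (a * b) = (k *: a) * b.
Proof.
apply/ffunP => g; rewrite galg_scaleE !ffunE mulr_sumr.
by apply: eq_bigr => h _; rewrite galg_scaleE mulrA.
Qed.

Lemma galg_scaleAr (k : R[i]) a b : k *: (a * b) = a * (k *: b).
Proof.
apply/ffunP => g; rewrite galg_scaleE !ffunE mulr_sumr.
by apply: eq_bigr => h _; rewrite galg_scaleE mulrCA.
Qed.

HB.instance Definition _ := GRing.Lmodule_isLalgebra.Build R[i] galg galg_scaleAl.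
HB.instance Definition _ := GRing.Lalgebra_isAlgebra.Build R[i] galg galg_scaleAr.

Lemma galg_mulE a b g : (a * b) g = \sum_h a h * b (h^-1 * g)%g.
Proof. by rewrite ffunE. Qed.

Lemma galg_oneE g : (1 : galg) g = (g == 1%g)%:R.
Proof. by rewrite ffunE. Qed.

Lemma galg_starK : involutive galg_star.
Proof. by move=> a; apply/ffunP => g; rewrite !ffunE invgK conjCK. Qed.

Lemma galg_starD : {morph galg_star : x y / x + y}.
Proof. by move=> a b; apply/ffunP => g; rewrite !ffunE rmorphD. Qed.

Lemma galg_starZ (k : R[i]) a : galg_star (k *: a) = k^* *: galg_star a.
Proof. by apply/ffunP => g; rewrite galg_scaleE !ffunE rmorphM. Qed.

Lemma galg_starM a b : galg_star (a * b) = galg_star b * galg_star a.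
Proof.
apply/ffunP => g; rewrite !ffunE rmorph_sum /= (reindex_inj (mulgI g^-1%g)).
apply: eq_bigr => k _; rewrite rmorphM mulrC !ffunE.
by rewrite !invMg !invgK mulgK.
Qed.

Lemma galg_expand a : a = \sum_g a g *: gdelta g.
Proof.
apply/ffunP => h; rewrite galg_sumE (bigD1 h) //= big1 => [|g /negPf gh].
  by rewrite galg_scaleE ffunE eqxx mulr1 addr0.
by rewrite galg_scaleE ffunE eq_sym gh mulr0.
Qed.

Lemma gdelta1 : gdelta 1%g = 1.
Proof. by []. Qed.

Lemma gdeltaM g h : gdelta g * gdelta h = gdelta (g * h)%g.
Proof.
apply/ffunP => k; rewrite galg_mulE (bigD1 g) //= big1 => [|l /negPf lg].
  by rewrite !ffunE eqxx mul1r addr0 -(inj_eq (mulgI g)) mulKVg.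
by rewrite !ffunE lg mul0r.
Qed.

Lemma gdelta_mulE g a h : (gdelta g * a) h = a (g^-1 * h)%g.
Proof.
rewrite galg_mulE (bigD1 g) //= big1 => [|l /negPf lg].
  by rewrite ffunE eqxx mul1r addr0.
by rewrite ffunE lg mul0r.
Qed.

Lemma galg_star_delta g : galg_star (gdelta g) = gdelta g^-1%g.
Proof.
apply/ffunP => h; rewrite !ffunE conjC_nat.
by rewrite -(inj_eq invg_inj) invgK.
Qed.

End GroupAlgebraOps.

Section GroupAlgebraNorm.
Variables (R : realType) (G : finGroupType).
Local Notation A := (galg R G).
Local Notation nc := (@Normc.normc R).
Implicit Types a b x y : A.

Lemma normc_ge0 (k : R[i]) : 0 <= nc k.
Proof. by case: k => r s /=; exact: sqrtr_ge0. Qed.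

Lemma normc_norm (k : R[i]) : `|k| = (nc k)%:C%C.
Proof. by []. Qed.

Lemma normc_conj (k : R[i]) : nc k^* = nc k.
Proof. by case: k => r s /=; rewrite sqrrN. Qed.

Lemma normc_triangle (k l : R[i]) : nc (k + l) <= nc k + nc l.
Proof. exact: (@le_normcD R k l). Qed.

Lemma normc_sqE (k : R[i]) : nc k ^+ 2 = complex.Re k ^+ 2 + complex.Im k ^+ 2.
Proof. by case: k => r s /=; rewrite sqr_sqrtr // addr_ge0 ?sqr_ge0. Qed.

Lemma normc_le_ReIm (k : R[i]) : nc k <= `|complex.Re k| + `|complex.Im k|.
Proof.
rewrite -ler_sqr ?nnegrE ?normc_ge0 ?addr_ge0 // normc_sqE sqrrD !real_normK ?num_real //.
by rewrite [leRHS]addrAC lerDl mulrn_wge0 // mulr_ge0.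
Qed.

Lemma normc_geRe (k : R[i]) : `|complex.Re k| <= nc k.
Proof.
rewrite -ler_sqr ?nnegrE ?normc_ge0 // normc_sqE real_normK ?num_real //.
by rewrite lerDl sqr_ge0.
Qed.

Lemma normc_geIm (k : R[i]) : `|complex.Im k| <= nc k.
Proof.
rewrite -ler_sqr ?nnegrE ?normc_ge0 // normc_sqE real_normK ?num_real //.
by rewrite lerDr sqr_ge0.
Qed.

Definition rip a b : R := \sum_g complex.Re (a g * (b g)^*).
Definition l2norm a : R := Num.sqrt (rip a a).

Lemma ReD (k l : R[i]) : complex.Re (k + l) = complex.Re k + complex.Re l.
Proof. by case: k l => [? ?] [? ?]. Qed.

Lemma Re_sum (I : Type) (r : seq I) (P : pred I) (F : I -> R[i]) :
  complex.Re (\sum_(i <- r | P i) F i) = \sum_(i <- r | P i) complex.Re (F i).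
Proof. by apply: (big_morph (@complex.Re R)) => [k l|]; rewrite ?ReD. Qed.

Lemma Re_mulconj (k l : R[i]) : complex.Re (k * l^*) =
  complex.Re k * complex.Re l + complex.Im k * complex.Im l.
Proof. by case: k l => [? ?] [? ?] /=; rewrite mulrN opprK. Qed.

Lemma rip_sym a b : rip a b = rip b a.
Proof.
by apply: eq_bigr => g _; rewrite !Re_mulconj [X in X + _]mulrC [X in _ + X]mulrC.
Qed.

Lemma ripaaE a : rip a a = \sum_g nc (a g) ^+ 2.
Proof. by apply: eq_bigr => g _; rewrite Re_mulconj normc_sqE. Qed.

Lemma rip_ge0 a : 0 <= rip a a.
Proof. by rewrite ripaaE sumr_ge0 // => g _; rewrite sqr_ge0. Qed.

Lemma l2norm_ge0 a : 0 <= l2norm a. Proof. exact: sqrtr_ge0. Qed.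

Lemma l2norm_sq a : l2norm a ^+ 2 = rip a a.
Proof. by rewrite sqr_sqrtr // rip_ge0. Qed.

Lemma ripDl a b c : rip (a + b) c = rip a c + rip b c.
Proof.
by rewrite -big_split; apply: eq_bigr => g _; rewrite galg_addE mulrDl ReD.
Qed.

Lemma ripZl (r : R) a b : rip (r%:C%C *: a) b = r * rip a b.
Proof.
rewrite mulr_sumr; apply: eq_bigr => g _; rewrite galg_scaleE -mulrA.
by case: (a g * _) => ? ? /=; rewrite mul0r subr0.
Qed.

Lemma ripDr a b c : rip c (a + b) = rip c a + rip c b.
Proof. by rewrite rip_sym ripDl !(rip_sym c). Qed.

Lemma ripZr (r : R) a b : rip a (r%:C%C *: b) = r * rip a b.
Proof. by rewrite rip_sym ripZl rip_sym. Qed.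

Lemma l2norm_eq0 a : l2norm a = 0 -> a = 0.
Proof.
move=> a0; have : rip a a == 0 by rewrite -l2norm_sq a0 expr0n.
rewrite ripaaE psumr_eq0 => [|g _]; last exact: sqr_ge0.
move=> /allP h; apply/ffunP => g; rewrite [RHS]ffunE; apply: Normc.eq0_normc.
by apply/eqP; have := h g (mem_index_enum g); rewrite sqrf_eq0.
Qed.

Lemma rip0l b : rip 0 b = 0.
Proof. by rewrite /rip big1 // => g _; rewrite ffunE mul0r. Qed.

Lemma rip_CS a b : rip a b <= l2norm a * l2norm b.
Proof.
have [/l2norm_eq0->|a0] := eqVneq (l2norm a) 0.
  by rewrite rip0l mulr_ge0 ?l2norm_ge0.
have [/l2norm_eq0->|b0] := eqVneq (l2norm b) 0.
  by rewrite rip_sym rip0l mulr_ge0 ?l2norm_ge0.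
have ab : 0 < l2norm a * l2norm b.
  by rewrite mulr_gt0 // lt_def l2norm_ge0 ?a0 ?b0.
have := rip_ge0 ((l2norm b)%:C%C *: a + (- l2norm a)%:C%C *: b).
rewrite !(ripDl, ripDr, ripZl, ripZr) (rip_sym b a) -!l2norm_sq.
set s := l2norm a in ab *; set t := l2norm b in ab *; set r := rip a b => h.
rewrite -(ler_pM2l ab) -subr_ge0 -(pmulrn_lge0 _ (ltn0Sn 1)).
by congr (0 <= _): h; rewrite mulr2n; ring.
Qed.

Lemma l2normD a b : l2norm (a + b) <= l2norm a + l2norm b.
Proof.
rewrite -ler_sqr ?nnegrE ?l2norm_ge0 ?addr_ge0 ?l2norm_ge0 //.
rewrite l2norm_sq ripDl !ripDr (rip_sym b a) sqrrD !l2norm_sq mulr2n.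
have := rip_CS a b; lra.
Qed.

Lemma l2normZ k a : l2norm (k *: a) = nc k * l2norm a.
Proof.
rewrite -[nc k]ger0_norm ?normc_ge0 // -sqrtr_sqr -sqrtrM ?sqr_ge0 //.
congr Num.sqrt; rewrite !ripaaE mulr_sumr; apply: eq_bigr => g _.
by rewrite galg_scaleE Normc.normcM exprMn.
Qed.

Lemma l2norm0 : l2norm 0 = 0.
Proof. by rewrite /l2norm rip0l sqrtr0. Qed.

Lemma l2norm_sum (I : Type) (r : seq I) (F : I -> A) :
  l2norm (\sum_(i <- r) F i) <= \sum_(i <- r) l2norm (F i).
Proof.
elim: r => [|i r IH]; first by rewrite !big_nil l2norm0.
by rewrite !big_cons (le_trans (l2normD _ _)) // lerD2l.
Qed.

Lemma l2norm_shift g a : l2norm (gdelta R g * a) = l2norm a.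
Proof.
congr Num.sqrt; rewrite !ripaaE (reindex_inj (mulgI g)).
by apply: eq_bigr => h _; rewrite gdelta_mulE mulKg.
Qed.

Lemma l2norm1 : l2norm 1 = 1.
Proof.
rewrite /l2norm ripaaE (bigD1 1%g) //= big1 => [|g /negPf g1].
  by rewrite galg_oneE eqxx Normc.normc1 expr1n addr0 sqrtr1.
by rewrite galg_oneE g1 Normc.normc0 expr0n.
Qed.

Lemma rip_star a x y : rip (a * x) y = rip x (galg_star a * y).
Proof.
rewrite /rip; under eq_bigr do rewrite galg_mulE mulr_suml Re_sum.
under [RHS]eq_bigr do rewrite galg_mulE rmorph_sum mulr_sumr Re_sum.
rewrite exchange_big [RHS]exchange_big (reindex_inj invg_inj) /=.
apply: eq_bigr => h _; rewrite (reindex_inj (mulgI h^-1%g)).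
apply: eq_bigr => k _; congr complex.Re.
by rewrite invgK mulKVg rmorphM ffunE /= conjCK mulrCA mulrA.
Qed.

Lemma l2norm_mul_le a x :
  l2norm (a * x) <= (\sum_g nc (a g)) * l2norm x.
Proof.
rewrite {1}(galg_expand a) mulr_suml (le_trans (l2norm_sum _ _)) // mulr_suml.
by apply: ler_sum => g _; rewrite -scalerAl l2normZ l2norm_shift.
Qed.

Definition opset a : set R := [set r | exists2 x, l2norm x <= 1 & r = l2norm (a * x)].

(* The norm of left multiplication by a on l^2(G). *)
Definition galg_norm a : R := sup (opset a).

Lemma opset_ub a : ubound (opset a) (\sum_g nc (a g)).
Proof.
move=> _ [x x1 ->]; apply: (le_trans (l2norm_mul_le a x)).
by rewrite ler_piMr // sumr_ge0 // => g _; exact: normc_ge0.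
Qed.

Lemma opset_nonempty a : opset a !=set0.
Proof. by exists (l2norm (a * 0)), 0; rewrite // l2norm0. Qed.

Lemma opset_has_sup a : has_sup (opset a).
Proof. by split; [exact: opset_nonempty | exists (\sum_g nc (a g)); exact: opset_ub]. Qed.

Lemma galg_norm_le_l1 a : galg_norm a <= \sum_g nc (a g).
Proof. by apply: ge_sup; [exact: opset_nonempty | exact: opset_ub]. Qed.

Lemma galg_normP a x : l2norm (a * x) <= galg_norm a * l2norm x.
Proof.
have [/l2norm_eq0->|x0] := eqVneq (l2norm x) 0; first by rewrite mulr0 l2norm0 mulr0.
have xp : 0 < l2norm x by rewrite lt_def x0 l2norm_ge0.
rewrite -ler_pdivrMr //; apply: ub_le_sup; first by case: (opset_has_sup a).
have nV : nc ((l2norm x)^-1)%:C%C = (l2norm x)^-1.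
  by rewrite /= expr0n /= addr0 sqrtr_sqr ger0_norm // invr_ge0 l2norm_ge0.
exists (((l2norm x)^-1)%:C%C *: x); first by rewrite l2normZ nV mulVf.
by rewrite -scalerAr l2normZ nV mulrC.
Qed.

Lemma galg_norm_ge0 a : 0 <= galg_norm a.
Proof. by have := galg_normP a 1; rewrite l2norm1 !mulr1; apply: le_trans; exact: l2norm_ge0. Qed.

Lemma galg_norm_le a (M : R) :
  0 <= M -> (forall x, l2norm (a * x) <= M * l2norm x) -> galg_norm a <= M.
Proof.
move=> M0 h; apply: ge_sup; first exact: opset_nonempty.
by move=> _ [x x1 ->]; rewrite (le_trans (h x)) // ler_piMr.
Qed.

Lemma galg_normD a b : galg_norm (a + b) <= galg_norm a + galg_norm b.
Proof.
apply: galg_norm_le => [|x]; first by rewrite addr_ge0 ?galg_norm_ge0.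
by rewrite mulrDl (le_trans (l2normD _ _)) // mulrDl lerD ?galg_normP.
Qed.

Lemma galg_normZ_le k a : galg_norm (k *: a) <= nc k * galg_norm a.
Proof.
apply: galg_norm_le => [|x]; first by rewrite mulr_ge0 ?galg_norm_ge0 ?normc_ge0.
by rewrite -scalerAl l2normZ -mulrA ler_wpM2l ?normc_ge0 ?galg_normP.
Qed.

Lemma galg_normZ k a : galg_norm (k *: a) = nc k * galg_norm a.
Proof.
apply/eqP; rewrite eq_le galg_normZ_le /=.
have [->|k0] := eqVneq k 0; first by rewrite Normc.normc0 mul0r galg_norm_ge0.
have nk : 0 < nc k.
  by rewrite lt_def normc_ge0 andbT; apply: contra k0 => /eqP/Normc.eq0_normc ->.
have := galg_normZ_le k^-1 (k *: a).
by rewrite scalerA mulVf // scale1r Normc.normcV ler_pdivlMl.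
Qed.

Lemma galg_norm_eq0 a : galg_norm a = 0 -> a = 0.
Proof.
move=> a0; apply: l2norm_eq0; apply/eqP; rewrite eq_le l2norm_ge0 andbT.
by have := galg_normP a 1; rewrite mulr1 a0 mul0r.
Qed.

Lemma galg_normM a b : galg_norm (a * b) <= galg_norm a * galg_norm b.
Proof.
apply: galg_norm_le => [|x]; first by rewrite mulr_ge0 ?galg_norm_ge0.
rewrite -mulrA (le_trans (galg_normP _ _)) // -mulrA.
by rewrite ler_wpM2l ?galg_norm_ge0 ?galg_normP.
Qed.

Lemma galg_norm_sq_le a : galg_norm a ^+ 2 <= galg_norm (galg_star a * a).
Proof.
set s := galg_norm (galg_star a * a).
have s0 : 0 <= s by exact: galg_norm_ge0.
rewrite -(sqr_sqrtr s0) ler_sqr ?nnegrE ?galg_norm_ge0 ?sqrtr_ge0 //.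
apply: galg_norm_le => [|x]; first exact: sqrtr_ge0.
rewrite -ler_sqr ?nnegrE ?mulr_ge0 ?sqrtr_ge0 ?l2norm_ge0 //.
rewrite exprMn (sqr_sqrtr s0) l2norm_sq rip_star rip_sym mulrA.
apply: (le_trans (rip_CS _ _)); rewrite expr2 mulrA ler_wpM2r ?l2norm_ge0 //.
exact: galg_normP.
Qed.

Lemma galg_norm_star_le a : galg_norm a <= galg_norm (galg_star a).
Proof.
have [->|a0] := eqVneq (galg_norm a) 0; first exact: galg_norm_ge0.
have ap : 0 < galg_norm a by rewrite lt_def a0 galg_norm_ge0.
by rewrite -(ler_pM2r ap) -expr2 (le_trans (galg_norm_sq_le a)) ?galg_normM.
Qed.

Lemma galg_cstar a : galg_norm (galg_star a * a) = galg_norm a ^+ 2.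
Proof.
apply/eqP; rewrite eq_le galg_norm_sq_le andbT (le_trans (galg_normM _ _)) //.
rewrite expr2 ler_wpM2r ?galg_norm_ge0 //.
by rewrite -{2}(galg_starK a) galg_norm_star_le.
Qed.

Lemma galg_norm_coef a g : nc (a g) <= galg_norm a.
Proof.
apply: (@le_trans _ _ (l2norm a)); last first.
  by have := galg_normP a 1; rewrite mulr1 l2norm1 mulr1.
rewrite -ler_sqr ?nnegrE ?normc_ge0 ?l2norm_ge0 // l2norm_sq ripaaE.
by rewrite (bigD1 g) //= lerDl sumr_ge0 // => h _; rewrite sqr_ge0.
Qed.

Lemma real_cauchy_cvg (u : nat -> R) :
  (forall e : R, 0 < e -> \forall m & n \near \oo, `|u m - u n| < e) ->
  exists l : R, u n @[n --> \oo] --> l.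
Proof.
move=> h; have : cauchy (u @ \oo).
  apply/cauchy_ballP => e e0; have := h e e0.
  by rewrite near_map2.
by move=> /R_complete c; exists (lim (u @ \oo)); exact: c.
Qed.

Lemma galg_complete (u : nat -> A) :
  (forall e : R, 0 < e -> \forall m & n \near \oo, galg_norm (u m - u n) < e) ->
  exists l : A, galg_norm (u n - l) @[n --> \oo] --> (0 : R).
Proof.
move=> h.
have cRe g : exists l : R, complex.Re (u n g) @[n --> \oo] --> l.
  apply: real_cauchy_cvg => e /h; apply: filterS => -[m n] /=.
  apply: le_lt_trans; apply: le_trans (galg_norm_coef _ g).
  apply: le_trans (normc_geRe _).
  by rewrite !ffunE; case: (u m g) (u n g) => [? ?] [? ?].
have cIm g : exists l : R, complex.Im (u n g) @[n --> \oo] --> l.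
  apply: real_cauchy_cvg => e /h; apply: filterS => -[m n] /=.
  apply: le_lt_trans; apply: le_trans (galg_norm_coef _ g).
  apply: le_trans (normc_geIm _).
  by rewrite !ffunE; case: (u m g) (u n g) => [? ?] [? ?].
have [re reP] := choice cRe; have [im imP] := choice cIm.
pose l : A := [ffun g => complex.Complex (re g) (im g)].
exists l.
apply: (@squeeze_cvgr _ _ _ _ (fun=> 0)
  (fun n => \sum_g (`|complex.Re (u n g) - re g| + `|complex.Im (u n g) - im g|))
  (fun n => galg_norm (u n - l))).
- apply: nearW => n; rewrite galg_norm_ge0 /= (le_trans (galg_norm_le_l1 _)) //.
  apply: ler_sum => g _; apply: (le_trans (normc_le_ReIm _)).
  by rewrite !ffunE; case: (u n g).
- exact: cvg_cst.
- have cabs (v : nat -> R) (w : R) : v n @[n --> \oo] --> w ->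
      `|v n - w| @[n --> \oo] --> (0 : R).
    move=> vw; have := cvg_norm (cvgB vw (cvg_cst w)).
    by rewrite subrr normr0; exact.
  elim: (index_enum G) => [|g r IH].
    by under eq_cvg do rewrite big_nil; exact: cvg_cst.
  under eq_cvg do rewrite big_cons.
  have := cvgD (cvgD (cabs _ _ (reP g)) (cabs _ _ (imP g))) IH.
  by rewrite !addr0; exact.
Qed.

HB.instance Definition _ := isCStarAlgebra.Build R (galg R G)
  (@galg_starK R G) (@galg_starD R G) (@galg_starZ R G) (@galg_starM R G)
  galg_normD galg_normZ galg_norm_eq0 galg_normM galg_cstar galg_complete.

End GroupAlgebraNorm.

Section CStarLemmas.
Variable R : realType.
Implicit Types A B T : cstarAlgType R.

Lemma cnorm0 A : cnorm (0 : A) = 0.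
Proof. by rewrite -(scale0r (0 : A)) cnormZ Normc.normc0 mul0r. Qed.

Lemma cnorm_ge0 A (x : A) : 0 <= cnorm x.
Proof.
have e : cnorm (- x) = cnorm x.
  rewrite -scaleN1r cnormZ (@normcN R 1) Normc.normc1 mul1r //.
have := cnormD x (- x); rewrite subrr cnorm0 e; lra.
Qed.

Section LinearPred.
Variables (U V : lmodType R[i]) (f : U -> V) (lf : linear f).

Lemma linpD x y : f (x + y) = f x + f y.
Proof. by have := lf 1 x y; rewrite !scale1r. Qed.

Lemma linp0 : f 0 = 0.
Proof. by apply: (addIr (f 0)); rewrite -linpD !add0r. Qed.

Lemma linpZ k x : f (k *: x) = k *: f x.
Proof. by have := lf k x 0; rewrite linp0 !addr0. Qed.

Lemma linp_sum (I : Type) (r : seq I) (P : pred I) (F : I -> U) :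
  f (\sum_(i <- r | P i) F i) = \sum_(i <- r | P i) f (F i).
Proof. by apply: (big_morph f); [exact: linpD | exact: linp0]. Qed.

End LinearPred.

Lemma subspace_sum A (S : set A) (I : Type) (r : seq I) (k : I -> R[i])
    (F : I -> A) :
  linear_subspace S -> (forall i, S (F i)) -> S (\sum_(i <- r) k i *: F i).
Proof.
move=> [S0 SD] h; elim: r => [|i r IH]; first by rewrite big_nil.
by rewrite big_cons; exact: SD.
Qed.

Lemma galg_spans_dense (G : finGroupType) (X : set (galg R G)) :
  (forall g, X (gdelta R g)) -> spans_dense X.
Proof.
move=> h S _ lS XS; apply/seteqP; split=> // x _.
by rewrite (galg_expand x); apply: subspace_sum => // g; exact: XS.
Qed.

Section Lift.
Variables (G : finGroupType) (T : cstarAlgType R) (rho : G -> T).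
Hypothesis rho1 : rho 1%g = 1.
Hypothesis rhoM : {morph rho : g h / (g * h)%g >-> g * h}.
Hypothesis rhoV : forall g, star (rho g) = rho g^-1%g.

Definition galg_lift (a : galg R G) : T := \sum_g a g *: rho g.

Lemma galg_lift_linear : linear galg_lift.
Proof.
move=> k a b; rewrite scaler_sumr -big_split; apply: eq_bigr => g _ /=.
by rewrite galg_addE galg_scaleE scalerDl scalerA.
Qed.

Lemma galg_lift_delta g : galg_lift (gdelta R g) = rho g.
Proof.
rewrite /galg_lift (bigD1 g) //= big1 => [|h /negPf hg].
  by rewrite ffunE eqxx scale1r addr0.
by rewrite ffunE hg scale0r.
Qed.

Lemma galg_lift_starhom : starhom galg_lift.
Proof.
split; first exact: galg_lift_linear.
- split; first by rewrite -(gdelta1 R G) galg_lift_delta.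
  move=> a b; rewrite /galg_lift mulr_suml.
  under eq_bigr do rewrite galg_mulE scaler_suml.
  rewrite exchange_big; apply: eq_bigr => h _.
  rewrite (reindex_inj (mulgI h)) mulr_sumr; apply: eq_bigr => k _ /=.
  by rewrite mulKg rhoM -scalerA -scalerAl -scalerAr.
- move=> a; rewrite /galg_lift.
  rewrite (big_morph (@star R T) (@starD R T) (id1 := 0)); last first.
    by apply: (addIr (star (0 : T))); rewrite -starD !add0r.
  rewrite (reindex_inj invg_inj); apply: eq_bigr => g _ /=.
  by rewrite starZ rhoV ffunE invgK.
Qed.

End Lift.

(* Injective *-homomorphisms do not decrease the norm: galg_norm a ^+ 2 is an
   eigenvalue of star a * a, hence of its image. This makes the norm of
   galg R (G * H) the minimal tensor norm. *)
Section Isometry.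
Variables (G : finGroupType).
Implicit Types a c x y : galg R G.

Lemma galg_mull_surj c : (forall y, c * y = 0 -> y = 0) -> exists y, c * y = 1.
Proof.
move=> h.
pose V : vectType R[i] := {ffun G -> R[i]^o}.
pose f (y : V) : V := c * (y : galg R G).
have lf : linear f by move=> k x y; rewrite /f mulrDr -scalerAr.
pose F : {linear V -> V} := HB.pack f (GRing.isLinear.Build R[i] V V _ f lf).
have kF : lker (linfun F) == 0%VS.
  apply/lker0P => x y; rewrite !lfunE /= => e.
  by apply/subr0_eq/h; rewrite mulrBr; apply/eqP; rewrite subr_eq0; apply/eqP.
exists ((linfun F)^-1%VF (1 : galg R G)).
by have := lker0_lfunVK kF (1 : galg R G); rewrite lfunE.
Qed.

Lemma galg_top_eigen a :
  exists2 y, y != 0 & (star a * a) * y = (galg_norm a ^+ 2)%:C%C *: y.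
Proof.
set h := star a * a; set r := galg_norm a ^+ 2.
pose c := r%:C%C *: 1 - h.
have [[y y0 cy]|noy] := pselect (exists2 y, y != 0 & c * y = 0).
  exists y => //; apply/esym/eqP; rewrite -subr_eq0.
  by rewrite -{1}(mul1r y) scalerAl -mulrBl; apply/eqP.
have inj y : c * y = 0 -> y = 0.
  by move=> cy; apply/eqP; apply: contrapT => /negP y0; apply: noy; exists y.
have [y cy] := galg_mull_surj inj.
have r0 : 0 <= r by rewrite sqr_ge0.
have starh : star h = h by rewrite /h starM starK.
have star1 : star (1 : galg R G) = 1.
  by rewrite -[LHS]mulr1 -{2}(starK 1) -starM mulr1 starK.
have starc : star c = c.
  have rC : (r%:C%C)^* = r%:C%C by exact: (conjc_real r).
  by apply: (addIr h); rewrite -{1}starh -starD /c !subrK starZ star1 rC.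
have yc : star y * c = 1 by rewrite -starc -starM cy star1.
pose K := galg_norm (star y).
have K0 : 0 <= K by exact: galg_norm_ge0.
have lex x : l2norm x ^+ 2 <= K ^+ 2 * l2norm (c * x) ^+ 2.
  rewrite -exprMn ler_sqr ?nnegrE ?mulr_ge0 ?l2norm_ge0 //.
  by rewrite -{1}(mul1r x) -yc -mulrA galg_normP.
have lec x : l2norm (c * x) ^+ 2 <=
    2 * r ^+ 2 * l2norm x ^+ 2 - 2 * r * l2norm (a * x) ^+ 2.
  have hx : l2norm (h * x) ^+ 2 <= r ^+ 2 * l2norm x ^+ 2.
    rewrite -exprMn ler_sqr ?nnegrE ?(mulr_ge0 r0) ?l2norm_ge0 //.
    by rewrite /r -galg_cstar; exact: galg_normP.
  have hip : rip (h * x) x = l2norm (a * x) ^+ 2.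
    by rewrite l2norm_sq rip_sym [RHS]rip_star mulrA.
  have -> : c * x = r%:C%C *: x + (-1)%:C%C *: (h * x).
    rewrite /c mulrBl -scalerAl mul1r; congr (_ + _).
    by rewrite -[LHS]scaleN1r; congr (_ *: _); rewrite rmorphN rmorph1.
  rewrite l2norm_sq !(ripDl, ripDr, ripZl, ripZr) (rip_sym x) hip -!l2norm_sq.
  by move: hx; nra.
pose M := 2 * r ^+ 2 * K ^+ 2.
have M0 : 0 <= M by apply: mulr_ge0; [apply: mulr_ge0|]; rewrite ?sqr_ge0 ?ler0n.
have M1 : 0 < M + 1 by rewrite ltr_wpDl.
have lea x : (M + 1) * l2norm (a * x) ^+ 2 <= M * r * l2norm x ^+ 2.
  have h1 : l2norm (a * x) ^+ 2 <= r * l2norm x ^+ 2.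
    by rewrite /r -exprMn ler_sqr ?nnegrE ?mulr_ge0 ?l2norm_ge0 ?galg_norm_ge0 ?galg_normP.
  have h2 := le_trans (lex x) (ler_wpM2l (sqr_ge0 K) (lec x)).
  have h3 := ler_wpM2l r0 h2.
  rewrite mulrDl mul1r.
  have -> : M * r * l2norm x ^+ 2 = M * l2norm (a * x) ^+ 2 +
    r * (K ^+ 2 * (2 * r ^+ 2 * l2norm x ^+ 2 - 2 * r * l2norm (a * x) ^+ 2)).
    by rewrite /M; ring.
  by rewrite lerD2l (le_trans h1).
have q0 : 0 <= M * r / (M + 1) by apply: divr_ge0; [exact: mulr_ge0 | exact: ltW].
have : galg_norm a <= Num.sqrt (M * r / (M + 1)).
  apply: galg_norm_le => [|x]; first exact: sqrtr_ge0.
  rewrite -ler_sqr ?nnegrE ?mulr_ge0 ?sqrtr_ge0 ?l2norm_ge0 // exprMn (sqr_sqrtr q0).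
  by rewrite mulrAC ler_pdivlMr // mulrC.
rewrite -ler_sqr ?nnegrE ?sqrtr_ge0 ?galg_norm_ge0 // (sqr_sqrtr q0) -/r.
rewrite ler_pdivlMr // => rle.
have r00 : r = 0 by apply: le_anti; rewrite r0 andbT; move: rle; rewrite mulrDr mulr1 mulrC; lra.
exists 1; first exact: oner_neq0.
have a0 : galg_norm a = 0 by apply/eqP; have /eqP := r00; rewrite sqrf_eq0.
by rewrite mulr1 r00 scale0r /h (galg_norm_eq0 a0) mulr0.
Qed.

Lemma galg_norm_min T (f : galg R G -> T) a :
  starhom f -> (forall x, f x = 0 -> x = 0) -> cnorm a <= cnorm (f a).
Proof.
move=> [lf [_ fM] fS] injf.
have [y y0 hy] := galg_top_eigen a.
have fy : 0 < cnorm (f y).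
  rewrite lt_def cnorm_ge0 andbT; apply: contra y0 => /eqP/cnorm0_eq0/injf ->.
  exact: eqxx.
have := cnormM (f (star a * a)) (f y).
rewrite -fM hy linpZ // cnormZ fM fS cnorm_star ler_pM2r //.
have -> : Normc.normc (galg_norm a ^+ 2)%:C%C = cnorm a ^+ 2.
  by rewrite /= expr0n addr0 sqrtr_sqr ger0_norm ?sqr_ge0.
by rewrite ler_sqr ?nnegrE ?cnorm_ge0.
Qed.

End Isometry.

(* K stands for G * H up to the bijection phi, so that both bracketings of a
   threefold tensor product can share one carrier. *)
Section Tensor.
Variables (G H K : finGroupType) (phi : K -> G * H) (psi : G * H -> K).
Hypothesis phiK : cancel phi psi.
Hypothesis psiK : cancel psi phi.
Hypothesis phiM : {morph phi : k l / (k * l)%g >-> (k * l)%g}.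

Definition galg_tens (a : galg R G) (b : galg R H) : galg R K :=
  [ffun k => a (phi k).1 * b (phi k).2].

Local Notation t := galg_tens.

Let phi1 : phi 1%g = 1%g.
Proof. by apply: (mulgI (phi 1%g)); rewrite -phiM !mulg1. Qed.

Let phiV k : phi k^-1%g = (phi k)^-1%g.
Proof. by apply: (mulgI (phi k)); rewrite -phiM !mulgV. Qed.

Let psi_bij : bijective psi. Proof. by exists phi. Qed.

Lemma galg_tens_delta g h : t (gdelta R g) (gdelta R h) = gdelta R (psi (g, h)).
Proof.
apply/ffunP => k; rewrite !ffunE -natrM mulnb.
rewrite -xpair_eqE -surjective_pairing [phi k == _]eq_sym.
by rewrite -(can2_eq psiK phiK) eq_sym.
Qed.

Lemma galg_tens_linearl b : linear (t^~ b).
Proof.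
by move=> k x y; apply/ffunP => l; rewrite galg_addE galg_scaleE !ffunE mulrDl mulrA.
Qed.

Lemma galg_tens_linearr a : linear (t a).
Proof.
move=> k x y; apply/ffunP => l.
by rewrite galg_addE galg_scaleE !ffunE mulrDr mulrCA.
Qed.

Lemma galg_tens_cstar : cstar_tensor t.
Proof.
split.
- exact: galg_tens_linearl.
- exact: galg_tens_linearr.
- move=> n a b indep ab0 i; apply/ffunP => h; rewrite [RHS]ffunE.
  apply: (indep (fun j => b j h)) => {i}; apply/ffunP => g.
  rewrite galg_sumE; have /ffunP /(_ (psi (g, h))) := ab0.
  rewrite galg_sumE !ffunE => e; rewrite -[RHS]e; apply: eq_bigr => i _.
  by rewrite galg_scaleE !ffunE psiK mulrC.
- apply/ffunP => k; rewrite !ffunE -natrM mulnb -xpair_eqE -surjective_pairing.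
  by rewrite -[(1%g, 1%g)]/(1%g : G * H) -phi1 (can_eq phiK).
- move=> a a' b b'; apply/ffunP => k; rewrite !ffunE.
  rewrite (reindex psi) /=; last by apply: onW_bij.
  rewrite big_distrlr /= pair_big /=; apply: eq_bigr => -[g h] _ /=.
  by rewrite !ffunE phiM phiV psiK /= mulrACA.
- move=> a b; apply/ffunP => k; rewrite !ffunE rmorphM.
  by rewrite phiV.
- apply: galg_spans_dense => k; exists (gdelta R (phi k).1), (gdelta R (phi k).2).
  by rewrite galg_tens_delta -surjective_pairing phiK.
Qed.

Lemma galg_tens_min : min_tensor t.
Proof.
split; first exact: galg_tens_cstar.
move=> T' t' [ll lr inj t1 tM tS _] n a b.
pose rho k := t' (gdelta R (phi k).1) (gdelta R (phi k).2).
have fh : starhom (galg_lift rho).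
  apply: galg_lift_starhom => [|k l|k]; rewrite /rho.
  - by rewrite phi1 !gdelta1.
  - by rewrite tM !gdeltaM phiM.
  - by rewrite tS phiV; congr t'; exact: galg_star_delta.
have fE x : galg_lift rho x = \sum_g t' (gdelta R g) [ffun h => x (psi (g, h))].
  rewrite /galg_lift (reindex psi) /=; last by apply: onW_bij.
  under [RHS]eq_bigr => g _.
    rewrite [X in t' _ X]galg_expand (linp_sum (lr _)).
    under eq_bigr => h _ do rewrite (linpZ (lr _)) ffunE.
    over.
  rewrite pair_big /=; apply: eq_bigr => -[g h] _ /=.
  by rewrite /rho psiK.
have ft x y : galg_lift rho (t x y) = t' x y.
  rewrite fE [in RHS](galg_expand x) (linp_sum (ll y)).
  apply: eq_bigr => g _; rewrite (linpZ (ll y)) -(linpZ (lr _)); congr t'.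
  by apply/ffunP => h; rewrite galg_scaleE !ffunE psiK.
have -> : \sum_i t' (a i) (b i) = galg_lift rho (\sum_i t (a i) (b i)).
  by case: fh => lf _ _; rewrite (linp_sum lf); apply: eq_bigr => i _; rewrite ft.
apply: galg_norm_min => // x fx0; apply/ffunP => k; rewrite [RHS]ffunE.
rewrite -(phiK k) (surjective_pairing (phi k)).
pose N := #|{: G}|.
have indep : forall c : 'I_N -> R[i], \sum_i c i *: gdelta R (enum_val i) = 0 ->
    forall i, c i = 0.
  move=> c /ffunP e i; have := e (enum_val i).
  rewrite galg_sumE [RHS]ffunE (bigD1 i) //= big1 => [|j /negPf ji].
    by rewrite galg_scaleE ffunE eqxx mulr1 addr0.
  by rewrite galg_scaleE ffunE (inj_eq enum_val_inj) eq_sym ji mulr0.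
have := inj N (fun i => gdelta R (enum_val i))
  (fun i => [ffun h => x (psi (enum_val i, h))]) indep.
have -> : \sum_(i < N) t' (gdelta R (enum_val i)) [ffun h => x (psi (enum_val i, h))] = 0.
  rewrite -[RHS]fx0 fE [RHS](reindex (@enum_val G predT)) //=.
  by apply: onW_bij; exact: enum_val_bij.
move=> /(_ erefl (enum_rank (phi k).1)) /ffunP /(_ (phi k).2).
by rewrite !ffunE enum_rankK.
Qed.

End Tensor.

Section Dual.
Variable G : finGroupType.

Definition dual_tens : galg R G -> galg R G -> galg R (G * G)%type :=
  galg_tens (@id (G * G)).

(* Linear extension of g |-> g (x) g. *)
Definition dual_comul : galg R G -> galg R (G * G)%type :=
  galg_lift (fun g => dual_tens (gdelta R g) (gdelta R g)).

Lemma dual_tens_delta g h :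
  dual_tens (gdelta R g) (gdelta R h) = gdelta R (g, h).
Proof. exact: (@galg_tens_delta _ _ _ id id). Qed.

Lemma dual_tensP : min_tensor dual_tens.
Proof. exact: (@galg_tens_min _ _ _ id id). Qed.

Lemma dual_comulE : dual_comul = galg_lift (fun g => gdelta R (g, g)).
Proof. by congr galg_lift; apply/funext => g; rewrite dual_tens_delta. Qed.

Lemma dual_comul_delta g : dual_comul (gdelta R g) = gdelta R (g, g).
Proof. by rewrite dual_comulE galg_lift_delta. Qed.

Lemma dual_comul_starhom : starhom dual_comul.
Proof.
rewrite dual_comulE; apply: galg_lift_starhom => [|g h|g] //.
- by rewrite gdeltaM.
- exact: galg_star_delta.
Qed.

Let psi3 (p : G * (G * G)) : (G * G) * G := ((p.1, p.2.1), p.2.2).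
Let phi3 (p : (G * G) * G) : G * (G * G) := (p.1.1, (p.1.2, p.2)).

Lemma linear_delta_ext (T : lmodType R[i]) (f h : galg R G -> T) :
  linear f -> linear h -> (forall g, f (gdelta R g) = h (gdelta R g)) ->
  forall a, f a = h a.
Proof.
move=> lf lh e a; rewrite (galg_expand a) (linp_sum lf) (linp_sum lh).
by apply: eq_bigr => g _; rewrite (linpZ lf) (linpZ lh) e.
Qed.

Lemma linear_comp (U V W : lmodType R[i]) (f : V -> W) (h : U -> V) :
  linear f -> linear h -> linear (fun x => f (h x)).
Proof. by move=> lf lh k x y; rewrite lh lf. Qed.

Lemma dual_coassoc : coassociative dual_tens dual_comul.
Proof.
have [lD _ _] := dual_comul_starhom.
pose tl := @galg_tens (G * G)%type G ((G * G) * G)%type id.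
pose tr := @galg_tens G (G * G)%type ((G * G) * G)%type phi3.
have tlP : min_tensor tl by exact: (@galg_tens_min _ _ _ id id).
have trP : min_tensor tr.
  by apply: (@galg_tens_min _ _ _ phi3 psi3) => [[[? ?] ?]|[? [? ?]]|[[? ?] ?] [[? ?] ?]].
have tlE p g : tl (gdelta R p) (gdelta R g) = gdelta R (p, g).
  exact: (@galg_tens_delta _ _ _ id id).
have trE g p : tr (gdelta R g) (gdelta R p) = gdelta R (psi3 (g, p)).
  by apply: (@galg_tens_delta _ _ _ phi3 psi3) => [[[? ?] ?]|[? [? ?]]].
have [[tll tlr _ _ _ _ _] _] := tlP; have [[trl trr _ _ _ _ _] _] := trP.
have [[dl dr _ _ _ _ _] _] := dual_tensP.
pose Dl := galg_lift (fun p : G * G => gdelta R ((p.1, p.1), p.2)).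
pose Dr := galg_lift (fun p : G * G => gdelta R ((p.1, p.2), p.2)).
have DlE p : Dl (gdelta R p) = gdelta R ((p.1, p.1), p.2).
  exact: galg_lift_delta.
have DrE p : Dr (gdelta R p) = gdelta R ((p.1, p.2), p.2).
  exact: galg_lift_delta.
have DlP : starhom Dl.
  apply: galg_lift_starhom => [|p q|p] //; first by rewrite gdeltaM.
  exact: galg_star_delta.
have DrP : starhom Dr.
  apply: galg_lift_starhom => [|p q|p] //; first by rewrite gdeltaM.
  exact: galg_star_delta.
have [lDl _ _] := DlP; have [lDr _ _] := DrP.
exists (galg R ((G * G) * G)%type), tl, tr, Dl, Dr; split.
- by [].
- by move=> a b c; apply/ffunP => -[[g h] k]; rewrite !ffunE /= mulrA.
- split; first exact: DlP.
  move=> a b; move: a.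
  apply: linear_delta_ext; [exact: (linear_comp lDl (dl b))|exact: (linear_comp (tll b) lD)|].
  move=> g; move: b.
  apply: linear_delta_ext; [exact: (linear_comp lDl (dr _))|exact: tlr|].
  by move=> h; rewrite dual_tens_delta DlE dual_comul_delta tlE.
- split; first exact: DrP.
  move=> a b; move: a.
  apply: linear_delta_ext; [exact: (linear_comp lDr (dl b))|exact: trl|].
  move=> g; move: b.
  apply: linear_delta_ext; [exact: (linear_comp lDr (dr _))|exact: (linear_comp (trr _) lD)|].
  by move=> h; rewrite dual_tens_delta DrE dual_comul_delta trE.
- apply: linear_delta_ext; [exact: (linear_comp lDl lD)|exact: (linear_comp lDr lD)|].
  by move=> g; rewrite dual_comul_delta DlE DrE.
Qed.

Lemma dual_cancell :
  spans_dense [set x | exists a b, x = dual_tens a 1 * dual_comul b].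
Proof.
apply: galg_spans_dense => -[g h].
exists (gdelta R (g * h^-1)%g), (gdelta R h).
rewrite -(gdelta1 R G) dual_tens_delta dual_comul_delta gdeltaM.
by congr (gdelta R (_, _)); rewrite ?mulgKV ?mul1g.
Qed.

Lemma dual_cancelr :
  spans_dense [set x | exists a b, x = dual_tens 1 a * dual_comul b].
Proof.
apply: galg_spans_dense => -[g h].
exists (gdelta R (h * g^-1)%g), (gdelta R g).
rewrite -(gdelta1 R G) dual_tens_delta dual_comul_delta gdeltaM.
by congr (gdelta R (_, _)); rewrite ?mulgKV ?mul1g.
Qed.

Definition dual : cqg R :=
  CQG dual_tensP dual_comul_starhom dual_coassoc dual_cancell dual_cancelr.

End Dual.
End CStarLemmas.

(* Main.v *)
Require Import Defs.
From mathcomp Require Import all_boot all_order all_algebra all_fingroup all_solvable.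
From mathcomp Require Import reals.
From mathcomp Require Import complex all_classical topology normedtype sequences.

(** Suppose that the dual of a finite group G is G^+(X), and let w be the image in
    C*(G) of the fundamental magic matrix. Expand w = sum_g w_g g with scalar
    matrices w_g. The comultiplication makes the w_g orthogonal idempotents
    (coefM), so that C^N is graded by G; as w commutes with the adjacency matrix d
    of X, so does every w_g. Since w is magic, the grading is compatible with the
    pointwise product of C^N, and commutativity of that product shows that two
    degrees which both occur at a given point commute in G (coef_commute).

    Now let r be a map from G to a finite group K that is multiplicative on
    commuting pairs. Then sum_g w_g r(g) is again a magic matrix commuting with d.
    By universality of G^+(X) there is a *-homomorphism from C*(G) to C*(K)
    carrying w to this matrix, and it restricts to a group morphism from G to K
    which coincides with r on the set of degrees that occur, a set that generates G
    (degrees_gen, degrees_extend). So every map that respects products of commuting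
    pairs has to agree, on these generators, with a group morphism.

    This is impossible when G is nonabelian, commutation is transitive on its
    nontrivial elements, and its derived subgroup G' is G or a maximal subgroup
    (dual_not_Frucht). Commutation transitivity says that distinct maximal abelian
    subgroups meet trivially, so that collapsing everything outside one of them is
    multiplicative on commuting pairs. Two noncommuting degrees g and h then
    give endomorphisms of G with abelian images, one fixing g and killing h and
    the other fixing h. The second shows that h is not in G', so G' and h generate
    G, and the first kills both of them although it fixes g.

    The groups S_3, A_4 and A_5 satisfy these hypotheses. Transitivity of
    commutation is decided on the list of permutations of the right parity. The
    group A_5 is perfect; S_3 and A_4 are 2-transitive on n points and have order
    at most 3 n, so their derived subgroups, being transitive, have index at
    most 3.

    On the analytic side, universality refers to closed ideals of C(S_N^+) and to
    topological generation; what is needed is that *-homomorphisms to the finite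
    dimensional algebras C*(K) are contractive (starhom_galg_contract). *)

Set Implicit Arguments.
Unset Strict Implicit.
Unset Printing Implicit Defensive.

Import numFieldNormedType.Exports.
Import Order.TTheory GRing.Theory Num.Theory.

(** * Star homomorphisms to group algebras are contractive *)

Section Contraction.
Local Open Scope classical_set_scope.
Local Open Scope ring_scope.
Variable R : realType.
Implicit Type A : cstarAlgType R.

Lemma cnormN A (x : A) : cnorm (- x) = cnorm x.
Proof. by rewrite -scaleN1r cnormZ (@normcN R 1) Normc.normc1 mul1r. Qed.

Lemma cnorm_sum A (I : Type) (r : seq I) (F : I -> A) :
  cnorm (\sum_(i <- r) F i) <= \sum_(i <- r) cnorm (F i).
Proof.
elim: r => [|i r IH]; first by rewrite !big_nil cnorm0.
by rewrite !big_cons (le_trans (cnormD _ _)) // lerD2l.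
Qed.

Lemma cnormX A (x : A) n : cnorm (x ^+ n) <= cnorm (1 : A) * cnorm x ^+ n.
Proof.
elim: n => [|n IH]; first by rewrite !expr0 mulr1.
rewrite exprSr (le_trans (cnormM _ _)) // exprSr mulrA.
by rewrite ler_wpM2r // cnorm_ge0.
Qed.

(** The Neumann series of z converges by comparison with a geometric series. *)
Lemma neumann_left_inverse A (z : A) : cnorm z < 1 -> exists s, s * (1 - z) = 1.
Proof.
move=> z1; set c := cnorm (1 : A).
have az : `|cnorm z| < 1 by rewrite ger0_norm ?cnorm_ge0.
pose u n : A := \sum_(0 <= k < n) z ^+ k.
have uB m n : (m <= n)%N -> cnorm (u n - u m) <= \sum_(m <= k < n) geometric c (cnorm z) k.
  move=> mn; rewrite /u (@big_cat_nat _ _ _ m 0 n) //= addrAC subrr add0r.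
  rewrite (le_trans (cnorm_sum _ _)) //.
  by apply: ler_sum => k _; exact: cnormX.
have [e e0|s us] := @cnorm_complete R A u.
  have /cvg_cauchy/cauchy_seriesP/(_ e e0) := is_cvg_geometric_series (a := c) az.
  move=> h.
  have h' : \forall m & n \near \oo, `|\sum_(m <= k < n) geometric c (cnorm z) k| < e.
    exact: h.
  rewrite near_swap in h'.
  apply: filterS2 h h' => -[m n] /= hmn hnm.
  have [mn|/ltnW nm] := leqP m n.
    by rewrite -cnormN opprB (le_lt_trans (uB _ _ mn)) // (le_lt_trans (ler_norm _)).
  by rewrite (le_lt_trans (uB _ _ nm)) // (le_lt_trans (ler_norm _)).
exists s; apply/eqP; rewrite -subr_eq0; apply/eqP/cnorm0_eq0.
have uz n : u n * (1 - z) = 1 - z ^+ n.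
  rewrite /u; elim: n => [|n IH]; first by rewrite big_nil mul0r expr0 subrr.
  by rewrite big_nat_recr //= mulrDl IH mulrBr mulr1 -exprSr addrA subrK.
have bound n : cnorm (s * (1 - z) - 1) <=
    cnorm (u n - s) * cnorm (1 - z) + geometric c (cnorm z) n.
  have -> : s * (1 - z) - 1 = - ((u n - s) * (1 - z) + z ^+ n).
    by rewrite [in RHS]mulrBl uz addrAC subrK opprB.
  by rewrite cnormN (le_trans (cnormD _ _)) // lerD ?cnormM ?cnormX.
have lim0 : cnorm (u n - s) * cnorm (1 - z) + geometric c (cnorm z) n @[n --> \oo] --> (0 : R).
  rewrite -[X in _ --> X]addr0; apply: cvgD; last exact: cvg_geometric.
  rewrite -(mul0r (cnorm (1 - z))).
  by apply: cvgM => //; exact: cvg_cst.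
apply/eqP; rewrite eq_le cnorm_ge0 andbT.
by apply: (cvgr_to_ge lim0); exact: nearW bound.
Qed.

(** If the norm of F x exceeded that of x, then z = x^* x / |F x|^2 would have
    norm less than 1, so 1 - z would be left invertible; but F (1 - z) kills an
    eigenvector of (F x)^* (F x) for the eigenvalue |F x|^2. *)
Lemma starhom_galg_contract A (K : finGroupType) (F : A -> galg R K) x :
  starhom F -> galg_norm (F x) <= cnorm x.
Proof.
move=> [lF [F1 FM] FS]; rewrite leNgt; apply/negP => lt_xF.
set r := galg_norm (F x) ^+ 2.
have r0 : 0 < r by rewrite exprn_gt0 // (le_lt_trans (cnorm_ge0 _) lt_xF).
have [y y0 ey] := galg_top_eigen (F x).
have rC : (r%:C)%C != 0 by rewrite (inj_eq (@complexI R)) gt_eqF.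
pose z := (r%:C)%C^-1 *: (star x * x).
have [|s sz] := @neumann_left_inverse _ z.
  rewrite cnormZ Normc.normcV cnorm_star /= expr0n addr0 sqrtr_sqr gtr0_norm //.
  by rewrite mulrC ltr_pdivrMr // mul1r ltr_sqr ?nnegrE ?cnorm_ge0 ?galg_norm_ge0.
have zy : F z * y = y.
  by rewrite (linpZ lF) FM FS -scalerAl ey scalerA mulVf // scale1r.
case/eqP: y0; rewrite -(mul1r y) -F1 -sz FM -mulrA.
by rewrite addrC -scaleN1r lF F1 mulrDl mul1r -scalerAl zy scaleN1r addNr mulr0.
Qed.

End Contraction.

(** * The fundamental magic matrix in the group algebra *)

Section Model.
Local Open Scope classical_set_scope.
Local Open Scope ring_scope.
Variables (R : realType) (G : finGroupType).
Implicit Types A B : cstarAlgType R.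

Lemma linpB (U V : lmodType R[i]) (f : U -> V) :
  linear f -> forall x y, f (x - y) = f x - f y.
Proof. by move=> lf x y; rewrite -scaleN1r addrC lf scaleN1r addrC. Qed.

Lemma starhom_comp A B (C : cstarAlgType R) (f : B -> C) (h : A -> B) :
  starhom f -> starhom h -> starhom (f \o h).
Proof.
move=> [lf [f1 fM] fS] [lh [h1 hM] hS]; split=> /=.
- by move=> k x y; rewrite /= lh lf.
- by split=> [|x y] /=; rewrite ?h1 ?hM.
- by move=> x; rewrite hS fS.
Qed.

Lemma starhom_inv A B (f : A -> B) (g : B -> A) :
  cancel f g -> cancel g f -> starhom f -> starhom g.
Proof.
move=> fK gK [lf [f1 fM] fS]; have fI := can_inj fK; split.
- by move=> k x y; apply: fI; rewrite lf !gK.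
- by split=> [|x y]; apply: fI; rewrite ?fM !gK.
- by move=> x; apply: fI; rewrite fS !gK.
Qed.

Lemma starhom_magic A B (f : A -> B) N (u : 'M[A]_N) :
  starhom f -> magic u -> magic (map_mx f u).
Proof.
move=> [lf [f1 fM] fS] [pu ru cu]; split.
- by move=> i j; rewrite mxE /projection -fM -fS; have [-> ->] := pu i j.
- by move=> i; under eq_bigr do rewrite mxE; rewrite -(linp_sum lf) ru f1.
- by move=> j; under eq_bigr do rewrite mxE; rewrite -(linp_sum lf) cu f1.
Qed.

Lemma starhom_adj_comm A B (f : A -> B) N (X : graph N) (u : 'M[A]_N) i j :
  starhom f -> f ((adjmx A X *m u - u *m adjmx A X) i j) =
  (adjmx B X *m map_mx f u - map_mx f u *m adjmx B X) i j.
Proof.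
move=> [lf [f1 fM] fS].
have f01 (b : bool) : f b%:R = b%:R by case: b; rewrite ?f1 ?(linp0 lf).
rewrite !mxE (linpB lf) !(linp_sum lf).
by congr (_ - _); apply: eq_bigr => k _; rewrite !mxE fM f01.
Qed.

(** Continuity of *-homomorphisms to group algebras, in the form in which closed
    ideals and closed subalgebras of C(S_N^+) use it. *)
Lemma starhom_galg_cclosed_preim A (K : finGroupType) (F : A -> galg R K)
    (S : set (galg R K)) :
  starhom F -> cclosed S -> cclosed (F @^-1` S).
Proof.
move=> hF cS u l uS ul; apply: (cS (F \o u)) => //=.
have [lF _ _] := hF.
apply: (squeeze_cvgr _ (@cvg_cst _ (0 : R) _ _ _) ul).
apply: nearW => n; rewrite cnorm_ge0 -(linpB lF) /=.
exact: starhom_galg_contract.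
Qed.

Lemma cclosed0 A : cclosed [set 0 : A].
Proof.
move=> u l u0 ul; apply/cnorm0_eq0/eqP; rewrite eq_le cnorm_ge0 andbT.
have le_u n : cnorm l <= cnorm (u n - l) by rewrite u0 sub0r cnormN.
by apply: (cvgr_to_ge ul); exact: nearW le_u.
Qed.

Lemma starhom_galg_ideal_of A (K : finGroupType) (F : A -> galg R K) (X : set A) :
  starhom F -> (forall x, X x -> F x = 0) -> forall x, ideal_of X x -> F x = 0.
Proof.
move=> hF X0 x; have [lF [_ FM] _] := hF.
move=> /(_ (F @^-1` [set 0])); apply; last exact: X0.
split.
- by apply: (starhom_galg_cclosed_preim hF); exact: cclosed0.
- split=> [|k y z /= y0 z0]; first exact: (linp0 lF).
  by rewrite lF y0 z0 scaler0 addr0.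
- by move=> a b y /= y0; rewrite !FM y0 mulr0 mul0r.
Qed.

(** Universal property of the quotient, for group algebra targets: the kernel of
    F is a closed ideal, hence contains the one generated by X. *)
Lemma quotient_factor A B (K : finGroupType) (X : set A) (q : A -> B)
    (F : A -> galg R K) :
  is_quotient X q -> starhom F -> (forall x, X x -> F x = 0) ->
  exists2 phi : B -> galg R K, starhom phi & forall x, phi (q x) = F x.
Proof.
move=> [[lq [q1 qM] qS] /choice[s sK] kq] hF X0.
have [lF [F1 FM] FS] := hF.
have sF x y : q x = q y -> F x = F y.
  move=> e; apply/eqP; rewrite -subr_eq0 -(linpB lF); apply/eqP.
  by apply: (starhom_galg_ideal_of hF X0); apply/kq; rewrite (linpB lq) e subrr.
have phiE x : F (s (q x)) = F x by apply: sF; rewrite sK.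
exists (F \o s) => //; split=> /=.
- by move=> k x y; rewrite -(lF k (s x) (s y)); apply: sF; rewrite lq !sK.
- split=> [|x y] /=; first by rewrite -F1; apply: sF; rewrite sK q1.
  by rewrite -FM; apply: sF; rewrite qM !sK.
- by move=> x; rewrite -FS; apply: sF; rewrite qS !sK.
Qed.

(** The elements f (gdelta g) are linearly independent, and the algebraic tensor
    square of C(H) embeds in qfun2 H; so an identity in C*(G) (x) C*(G) can be
    checked after transport to H. *)
Lemma galg_tensor_square_inj (H : cqg R) (f : galg R G -> qfun H)
    (f2 : galg R (G * G)%type -> qfun2 H) :
  injective f -> linear f -> linear f2 ->
  (forall a b, f2 (dual_tens a b) = qtens (f a) (f b)) -> injective f2.
Proof.
move=> fI lf lf2 f2E.
have [[tl tr tinj _ _ _ _] _] := qtensP H.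
have dE : forall x, f2 x = \sum_g qtens (f (gdelta R g)) (f [ffun h => x (g, h)]).
  move=> x; rewrite [in LHS](galg_expand x) (linp_sum lf2).
  under [RHS]eq_bigr => g _.
    rewrite [X in qtens _ (f X)]galg_expand (linp_sum lf) (linp_sum (tr _)).
    under eq_bigr => h _.
      rewrite (linpZ lf) (linpZ (tr _)) -f2E dual_tens_delta -(linpZ lf2) ffunE.
      over.
    over.
  by rewrite pair_big /=; apply: eq_bigr => -[g h] _; rewrite (linpZ lf2).
suff ker0 x : f2 x = 0 -> x = 0.
  by move=> x y e; apply/subr0_eq/ker0; rewrite (linpB lf2) e subrr.
move=> x0; apply/ffunP => -[g h]; rewrite [RHS]ffunE.
pose a (i : 'I_#|G|) := f (gdelta R (enum_val i)).
pose b (i : 'I_#|G|) := f [ffun h => x (enum_val i, h)].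
have b0 : forall i, b i = 0.
  apply: (tinj _ a b).
    move=> c c0 i; have : \sum_i c i *: gdelta R (enum_val i) = 0 :> galg R G.
      apply: fI; rewrite (linp0 lf) (linp_sum lf) -[RHS]c0.
      by apply: eq_bigr => j _; rewrite (linpZ lf).
    move/ffunP => /(_ (enum_val i)).
    rewrite galg_sumE [RHS]ffunE (bigD1 i) //= big1 => [|j /negPf ji].
      by rewrite galg_scaleE ffunE eqxx mulr1 addr0.
    by rewrite galg_scaleE ffunE (inj_eq enum_val_inj) eq_sym ji mulr0.
  rewrite -[RHS]x0 dE [RHS](reindex (@enum_val G predT)) //=.
  by apply: onW_bij; exact: enum_val_bij.
have := b0 (enum_rank g); rewrite /b enum_rankK -(linp0 lf).
by move=> /fI/ffunP/(_ h); rewrite !ffunE.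
Qed.

(** The trace left in C*(G) by an isomorphism between the dual of G and G^+(X):
    w is the image of the fundamental magic matrix. The universal property
    dm_univ is recorded for group algebra targets, which are all that the
    argument maps to. *)
Record dual_magic N (X : graph N) (w : 'M[galg R G]_N) : Prop := DualMagic {
  dm_magic : magic w;
  dm_adj : adjmx (galg R G) X *m w = w *m adjmx (galg R G) X;
  dm_gen : cstar_generated (entries w);
  dm_comul : forall i j,
    dual_comul (w i j) = \sum_k dual_tens (w i k) (w k j);
  dm_univ : forall (K : finGroupType) (v : 'M[galg R K]_N), magic v ->
    adjmx (galg R K) X *m v = v *m adjmx (galg R K) X ->
    exists2 phi : galg R G -> galg R K, starhom phi &
      forall i j, phi (w i j) = v i j }.

Lemma Frucht_dual_magic : Frucht (dual R G) ->
  exists N (X : graph N) (w : 'M[galg R G]_N), dual_magic X w.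
Proof.
move=> [N [X [H [[P [u [p [[[mu gu uu] comu] qp [hp [p2 hp2 [p2E p2D]]]]]]]
  [f [g fK gK] [hf [f2 hf2 [f2E f2D]]]]]]]].
pose q : qfun P -> galg R G := g \o p.
have hg : starhom g := starhom_inv fK gK hf.
have hq : starhom q := starhom_comp hg hp.
have [lf _ _] := hf; have [lf2 _ _] := hf2; have [lp2 _ _] := hp2.
have fq x : f (q x) = p x by rewrite /q /= gK.
have [_ ps kp] := qp.
have qq : is_quotient (entries (adjmx (qfun P) X *m u - u *m adjmx (qfun P) X)) q.
  split=> //.
    by move=> y; have [x xy] := ps (f y); exists x; rewrite /q /= xy fK.
  move=> x; rewrite -kp -fq -(linp0 lf); split=> [->//|]; exact: (can_inj fK).
exists N, X, (map_mx q u); split.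
- exact: starhom_magic.
- apply/eqP; rewrite -subr_eq0; apply/eqP/matrixP => i j.
  rewrite -(starhom_adj_comm _ _ _ _ hq) [RHS]mxE; have [_ _ kq] := qq.
  by apply/kq => J _; apply; exists i, j.
- move=> S [cS lS S1 SM SS] wS.
  have [lq [q1 qM] qS] := hq.
  have : q @^-1` S = setT.
    apply: gu.
      split=> /=.
      + exact: starhom_galg_cclosed_preim.
      + split=> [|k x y /= Sx Sy]; first by rewrite /= (linp0 lq); case: lS.
        by rewrite lq; apply: (proj2 lS).
      + by rewrite q1.
      + by move=> x y Sx Sy; rewrite qM; exact: SM.
      + by move=> x Sx; rewrite qS; exact: SS.
    by move=> _ [i [j ->]]; apply: wS; exists i, j; rewrite mxE.
  (* q is onto, so S is everything as soon as its preimage is. *)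
  move=> e; apply/seteqP; split=> // y _.
  have [_ qs _] := qq; have [x <-] := qs y.
  by have : (q @^-1` S) x by rewrite e.
- move=> i j; apply: (galg_tensor_square_inj (can_inj fK) lf lf2 f2E).
  rewrite -/(qcomul (c := dual R G) _) f2D !mxE fq -p2D comu (linp_sum lp2).
  rewrite (linp_sum lf2); apply: eq_bigr => k _.
  by rewrite p2E f2E !mxE !fq.
- move=> K v mv cv.
  have [F hF FE] := uu _ v mv.
  have mF : map_mx F u = v by apply/matrixP => i j; rewrite mxE FE.
  have [|phi hphi phiE] := quotient_factor qq hF.
    move=> _ [i [j ->]]; rewrite (starhom_adj_comm _ _ _ _ hF) mF cv.
    by rewrite subrr mxE.
  by exists phi => // i j; rewrite mxE phiE FE.
Qed.

End Model.

(** * Degrees and their relabellings *)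

Section Rows.
Local Open Scope classical_set_scope.
Local Open Scope ring_scope.
Variables (R : realType) (G : finGroupType).

(** In a Hilbert space, projections that sum to 1 are orthogonal: expanding
    |y|^2 = sum_i |p_i y|^2 at y = p_k, the term i = k already gives |p_k|^2. *)
Lemma galg_projection_orth N (p : 'I_N -> galg R G) j k :
  (forall i, projection (p i)) -> \sum_i p i = 1 -> j != k -> p j * p k = 0.
Proof.
move=> pP p1 jk; have [pM pS] : (forall i, p i * p i = p i) /\ forall i, galg_star (p i) = p i.
  by split=> i; have [] := pP i.
have ripp i : rip (p i * p k) (p k) = rip (p i * p k) (p i * p k).
  by rewrite [RHS]rip_star pS mulrA pM rip_sym.
have : \sum_i rip (p i * p k) (p i * p k) = rip (p k * p k) (p k * p k).
  under eq_bigr do rewrite -ripp.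
  rewrite pM -{3}(mul1r (p k)) -p1 mulr_suml.
  by apply/esym/(big_morph (fun a => rip a (p k))) => [a b|]; rewrite ?ripDl ?rip0l.
rewrite (bigD1 k) //= -[RHS]addr0 => /addrI/eqP.
rewrite psumr_eq0 => [/allP/(_ j (mem_index_enum j))|i _]; last exact: rip_ge0.
rewrite jk implyTb -l2norm_sq sqrf_eq0 => /eqP; exact: l2norm_eq0.
Qed.

Lemma magic_row_comm N (w : 'M[galg R G]_N) i j k :
  magic w -> w i j * w i k = w i k * w i j.
Proof.
move=> [wP w1 _]; have [->//|jk] := eqVneq j k.
by rewrite !(galg_projection_orth (wP i) (w1 i)) // eq_sym.
Qed.

End Rows.

(** Relabelling the basis of C*(G) by a map r which is multiplicative only on
    commuting pairs gives a linear map, compatible with products of elements with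
    commuting supports. That is enough to preserve magic matrices whose entries
    have commuting supports. *)
Section Push.
Local Open Scope classical_set_scope.
Local Open Scope ring_scope.
Variables (R : realType) (G K : finGroupType) (r : G -> K).
Hypothesis rM : forall g h, commute g h -> r (g * h)%g = (r g * r h)%g.

Definition galg_push : galg R G -> galg R K := galg_lift (fun g => gdelta R (r g)).

Lemma galg_push_linear : linear galg_push. Proof. exact: galg_lift_linear. Qed.

Lemma galg_push_delta g : galg_push (gdelta R g) = gdelta R (r g).
Proof. exact: galg_lift_delta. Qed.

Let r1 : r 1%g = 1%g.
Proof. by apply: (mulgI (r 1%g)); rewrite -rM ?mulg1 //; exact: commute1. Qed.

Let rV g : r g^-1%g = (r g)^-1%g.
Proof.
by apply: (mulgI (r g)); rewrite -rM ?mulgV //; exact/commuteV/commute_refl.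
Qed.

Lemma galg_push1 : galg_push 1 = 1.
Proof. by rewrite -(gdelta1 R G) galg_push_delta r1. Qed.

Lemma galg_pushM (a b : galg R G) :
  (forall g h, a g != 0 -> b h != 0 -> commute g h) ->
  galg_push (a * b) = galg_push a * galg_push b.
Proof.
move=> ab; rewrite /galg_push /galg_lift mulr_suml.
under eq_bigr do rewrite galg_mulE scaler_suml.
rewrite exchange_big; apply: eq_bigr => g _.
rewrite (reindex_inj (mulgI g)) mulr_sumr; apply: eq_bigr => h _ /=.
rewrite mulKg -scalerAl -scalerAr scalerA gdeltaM.
have [->|ag] := eqVneq (a g) 0; first by rewrite mul0r !scale0r.
have [->|bh] := eqVneq (b h) 0; first by rewrite mulr0 !scale0r.
by rewrite rM //; exact: ab.
Qed.

Lemma galg_push_star (a : galg R G) : star (galg_push a) = galg_push (star a).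
Proof.
rewrite /galg_push /galg_lift (big_morph _ (@starD R (galg R K)) (id1 := 0)).
  rewrite [RHS](reindex_inj invg_inj); apply: eq_bigr => g _ /=.
  by rewrite starZ [star (gdelta _ _)]galg_star_delta ffunE invgK rV.
by apply: (addIr (star (0 : galg R K))); rewrite -starD !add0r.
Qed.

Lemma galg_push_magic N (w : 'M[galg R G]_N) : magic w ->
  (forall i j g h, w i j g != 0 -> w i j h != 0 -> commute g h) ->
  magic (map_mx galg_push w).
Proof.
move=> [wP w1 w1'] wc; split.
- move=> i j; rewrite /projection mxE galg_push_star -galg_pushM; last exact: wc.
  by have [-> ->] := wP i j.
- move=> i; under eq_bigr do rewrite mxE.
  by rewrite -(linp_sum galg_push_linear) w1 galg_push1.
- move=> j; under eq_bigr do rewrite mxE.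
  by rewrite -(linp_sum galg_push_linear) w1' galg_push1.
Qed.

End Push.

Section NatMul.
Local Open Scope ring_scope.

Lemma natr_mull (A : pzRingType) (b : bool) (x : A) : b%:R * x = if b then x else 0.
Proof. by case: b; rewrite ?mul1r ?mul0r. Qed.

Lemma natr_mulr (A : pzRingType) (b : bool) (x : A) : x * b%:R = if b then x else 0.
Proof. by case: b; rewrite ?mulr1 ?mulr0. Qed.

End NatMul.

Section Degrees.
Local Open Scope classical_set_scope.
Local Open Scope ring_scope.
Variables (R : realType) (G : finGroupType) (N : nat) (X : graph N).
Variables (w : 'M[galg R G]_N) (dw : dual_magic X w).

(** Write w = sum_g w_g gdelta(g), with w_g a scalar matrix. Comparing coefficients
    in Delta(w_ij) = sum_k w_ik (x) w_kj, the w_g are orthogonal idempotents: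
    C^N is graded by G, and w_g is the projection onto degree g. *)
Lemma coefM i j g h :
  \sum_k w i k g * w k j h = if g == h then w i j g else 0.
Proof.
have -> : \sum_k w i k g * w k j h = dual_comul (w i j) (g, h).
  by rewrite (dm_comul dw) galg_sumE; apply: eq_bigr => k _; rewrite ffunE.
rewrite dual_comulE /galg_lift galg_sumE (bigD1 g) //= big1 => [|k kg].
  rewrite addr0 galg_scaleE ffunE xpair_eqE eqxx eq_sym /=.
  by case: eqP; rewrite ?mulr1 ?mulr0.
by rewrite galg_scaleE ffunE xpair_eqE eq_sym (negPf kg) mulr0.
Qed.

(** Since w w_g = w_g gdelta(g), the columns of w_g are eigenvectors of w with
    eigenvalue gdelta(g). *)
Lemma eigenvector i j g :
  \sum_k w k j g *: w i k = w i j g *: gdelta R g.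
Proof.
apply/ffunP => h; rewrite galg_sumE galg_scaleE ffunE.
under eq_bigr do rewrite galg_scaleE mulrC.
rewrite coefM; case: eqP => [->|_]; first by rewrite mulr1.
by rewrite mulr0.
Qed.

(** The grading of C^N is compatible with its pointwise product, because w is
    magic. As this product is commutative, homogeneous vectors of degrees g and h
    that are both nonzero at some point i force g h = h g. *)
Lemma coef_commute i j k g h : w i j g != 0 -> w i k h != 0 -> commute g h.
Proof.
move=> gij hik.
have : (w i j g *: gdelta R g) * (w i k h *: gdelta R h) =
       (w i k h *: gdelta R h) * (w i j g *: gdelta R g).
  rewrite -!eigenvector !mulr_suml; under eq_bigr do rewrite mulr_sumr.
  under [RHS]eq_bigr do rewrite mulr_sumr.
  rewrite [RHS]exchange_big; apply: eq_bigr => a _; apply: eq_bigr => b _.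
  rewrite -!scalerAl -!scalerAr !scalerA mulrC; congr (_ *: _).
  exact: magic_row_comm (dm_magic dw).
rewrite -!scalerAl -!scalerAr !scalerA !gdeltaM => /ffunP/(_ (g * h)%g).
rewrite !galg_scaleE !ffunE eqxx mulr1.
by case: eqP => // _ /eqP; rewrite mulr0 mulf_eq0 (negPf gij) (negPf hik).
Qed.

Definition degrees : {set G} := [set g | [exists i, exists j, w i j g != 0]]%SET.

(** The subalgebra C*(H) of C*(G); it is closed since coefficients are continuous. *)
Lemma galg_support_cstar (H : {group G}) :
  sub_cstar [set x : galg R G | forall g, x g != 0 -> g \in H].
Proof.
split=> /=.
- move=> u l uH ul g; apply: contraR => gH; apply/eqP/Normc.eq0_normc/eqP.
  rewrite eq_le normc_ge0 andbT.
  have le_u n : Normc.normc (l g) <= cnorm (u n - l).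
    have u0 : u n g = 0 by apply/eqP; apply: contraNT gH; exact: uH.
    by have := galg_norm_coef (u n - l) g; rewrite !ffunE u0 add0r normcN.
  by apply: (cvgr_to_ge ul); exact: nearW le_u.
- split=> [g|k x y xH yH g]; first by rewrite ffunE eqxx.
  rewrite galg_addE galg_scaleE; apply: contraR => gH.
  have [x0 y0] : x g = 0 /\ y g = 0.
    by split; apply/eqP; apply: contraNT gH; [exact: xH|exact: yH].
  by rewrite x0 y0 mulr0 addr0.
- by move=> g; rewrite galg_oneE; case: (g =P 1%g) => [->|_]; rewrite ?group1 ?eqxx.
- move=> x y xH yH g; apply: contraR => gH; rewrite galg_mulE big1 // => h _.
  have [->|/xH hH] := eqVneq (x h) 0; first by rewrite mul0r.
  have [->|/yH] := eqVneq (y (h^-1 * g)%g) 0; first by rewrite mulr0.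
  by rewrite groupMl ?groupV // (negPf gH).
- move=> x xH g; rewrite ffunE conjc_eq0 => /xH; by rewrite groupV.
Qed.

Lemma degrees_gen : <<degrees>>%g = [set: G]%SET.
Proof.
have /(_ _ (galg_support_cstar <<degrees>>%G)) := dm_gen dw.
have sub : entries w `<=` [set x : galg R G | forall g, x g != 0 -> g \in <<degrees>>%g].
  move=> _ [i [j ->]] g wg; apply: mem_gen; rewrite inE.
  by apply/existsP; exists i; apply/existsP; exists j.
move=> /(_ sub) e; apply/setP => g; rewrite inE.
have /(_ g) : [set x : galg R G | forall g, x g != 0 -> g \in <<degrees>>%g] (gdelta R g).
  by rewrite e.
by rewrite ffunE eqxx oner_eq0 => ->.
Qed.

(** Two linear maps that agree on the entries of w agree on the eigenvalues
    gdelta(g) of w, read off at a nonzero entry of an eigenvector. *)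
Lemma starhom_degrees (K : finGroupType) (phi : galg R G -> galg R K) (r : G -> K) g :
  linear phi -> (forall i j, phi (w i j) = galg_push r (w i j)) ->
  g \in degrees -> phi (gdelta R g) = gdelta R (r g).
Proof.
move=> lphi phiE; rewrite inE => /existsP[i /existsP[j gij]].
apply: (scalerI gij); rewrite -(linpZ lphi) -galg_push_delta.
rewrite -(linpZ (@galg_push_linear R _ _ r)) -eigenvector.
rewrite (linp_sum lphi) (linp_sum (@galg_push_linear R _ _ r)).
apply: eq_bigr => k _.
by rewrite (linpZ lphi) (linpZ (@galg_push_linear R _ _ r)) phiE.
Qed.

(** Relabelling w by r gives another magic matrix, because the degrees that meet in an
    entry of w commute, and it commutes with the adjacency matrix because every w_g
    does. So universality provides a *-homomorphism from C*(G) to C*(K), sending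
    gdelta(g) to gdelta(r g) for g in degrees. As degrees generate G, it maps all
    of G to K. *)
Lemma degrees_extend (K : finGroupType) (r : G -> K) :
  (forall g h, commute g h -> r (g * h)%g = (r g * r h)%g) ->
  exists rho : {morphism [set: G]%SET >-> K}, {in degrees, rho =1 r}.
Proof.
move=> rM.
have [||phi [lphi [phi1 phiM] _] phiE] := dm_univ dw (v := map_mx (@galg_push R _ _ r) w).
- apply: (galg_push_magic rM); first exact: dm_magic dw.
  by move=> i j g h; exact: coef_commute.
- have lr := @galg_push_linear R _ _ r.
  apply/matrixP => i j; have /matrixP/(_ i j) := dm_adj dw; rewrite !mxE => e.
  have := congr1 (@galg_push R _ _ r) e; rewrite !(linp_sum lr).
  under eq_bigr do rewrite mxE natr_mull (fun_if (@galg_push R _ _ r)) (linp0 lr).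
  under [in RHS]eq_bigr do rewrite mxE natr_mulr (fun_if (@galg_push R _ _ r)) (linp0 lr).
  move=> e'; under eq_bigr do rewrite !mxE natr_mull.
  by rewrite e'; apply: eq_bigr => k _; rewrite !mxE natr_mulr.
have deg g : g \in degrees -> phi (gdelta R g) = gdelta R (r g).
  by apply: starhom_degrees => // i j; rewrite phiE mxE.
have dI : injective (@gdelta R K).
  move=> g h /ffunP/(_ g); rewrite !ffunE eqxx.
  by case: eqP => // _ /eqP; rewrite oner_eq0.
pose H := [set g | `[< exists k, phi (gdelta R g) = gdelta R k >]]%SET.
have gH : group_set H.
  apply/group_setP; split=> [|g h]; rewrite !inE.
    by exists 1%g; rewrite !gdelta1 phi1.
  move=> [k gk] [l hl]; exists (k * l)%g.
  by rewrite -!gdeltaM phiM gk hl.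
have all_H g : exists k, phi (gdelta R g) = gdelta R k.
  have : g \in <<degrees>>%g by rewrite degrees_gen inE.
  have /fintype.subsetP : (<<degrees>> \subset Group gH)%g.
    rewrite gen_subG; apply/fintype.subsetP => h hd; rewrite inE; apply/asboolP.
    by exists (r h); exact: deg.
  by move=> /[apply]; rewrite inE => /asboolP.
have [rho rhoE] := choice all_H.
have rhoM : {in [set: G]%SET &, {morph rho : g h / (g * h)%g}}.
  by move=> g h _ _; apply: dI; rewrite -rhoE -!gdeltaM phiM !rhoE.
exists (Morphism rhoM) => g gd /=; apply: dI; rewrite -rhoE; exact: deg.
Qed.

End Degrees.

(** * Commutation transitive groups *)

Section CommutationTransitive.
Local Open Scope group_scope.
Variable G : finGroupType.

(** Equivalently, the centralizers of nontrivial elements are abelian. *)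
Definition commutation_transitive := forall x y z : G,
  y != 1 -> commute x y -> commute y z -> commute x z.

Hypothesis ct : commutation_transitive.

Definition cent_retract (g x : G) : G := if x \in 'C[g] then x else 1.

(** Distinct maximal abelian subgroups of G meet trivially, so a nontrivial x and any y
    commuting with it lie in the same one, and the map that keeps 'C[g] and
    collapses everything else is multiplicative on commuting pairs. *)
Lemma cent_retractM g : g != 1 -> forall x y, commute x y ->
  cent_retract g (x * y) = cent_retract g x * cent_retract g y.
Proof.
move=> g1 x y xy; rewrite /cent_retract.
have cP z : reflect (commute g z) (z \in 'C[g]).
  by apply: (iffP cent1P) => c; exact: commute_sym.
have [gx|/cP gx] := boolP (x \in 'C[g]); rewrite ?mul1g.
  rewrite groupMl //; have [//|/cP gy] := boolP (y \in 'C[g]).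
  have [->|x1] := eqVneq x 1; first by rewrite mulg1.
  by case: gy; apply: (ct x1) => //; exact/cP.
have [gy|/cP gy] := boolP (y \in 'C[g]); rewrite ?mulg1.
  rewrite groupMr //; case: ifP => [/cP//|_].
  have [->//|y1] := eqVneq y 1.
  by case: gx; apply: (ct y1); [exact/cP | exact: commute_sym].
case: ifP => // /cP gxy; have [//|xy1] := eqVneq (x * y) 1.
by case: gx; apply: (ct xy1) => //; apply/commute_sym/commuteM; [exact: commute_refl|].
Qed.

Lemma commute_cent_retract g x y :
  g != 1 -> commute (cent_retract g x) (cent_retract g y).
Proof.
move=> g1; rewrite /cent_retract.
case: cent1P => [xg|_]; last exact/commute_sym/commute1.
case: cent1P => [yg|_]; last exact: commute1.
by apply: (ct g1) => //; exact: commute_sym.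
Qed.

End CommutationTransitive.

Section Obstruction.
Local Open Scope group_scope.
Variable G : finGroupType.

(** Take two generators g and h in D that do not commute. Collapsing everything
    outside 'C[g], resp. 'C[h], yields two endomorphisms rg and rh of G with abelian
    images. As rh fixes h, h lies outside the derived subgroup; as rg kills h
    and the derived subgroup, it kills G by maximality; but rg fixes g. *)
Lemma ct_generators_not_free (D : {set G}) :
  ~~ abelian [set: G] -> commutation_transitive G ->
  maximal_eq [set: G]^`(1) [set: G] -> <<D>> = [set: G] ->
  (forall r : G -> G, (forall g h, commute g h -> r (g * h) = r g * r h) ->
    exists rho : {morphism [set: G] >-> G}, {in D, rho =1 r}) -> False.
Proof.
move=> nab ct maxG genD ext.
have [g [h [gD hD gh]]] : exists g h, [/\ g \in D, h \in D & ~ commute g h].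
  apply: contrapT => no; case/negP: nab; rewrite -genD abelian_gen.
  by apply/centsP => g gD h hD; apply: contrapT => gh; apply: no; exists g, h.
have g1 : g != 1 by apply/eqP => g1; apply: gh; rewrite g1; exact/commute_sym/commute1.
have h1 : h != 1 by apply/eqP => h1; apply: gh; rewrite h1; exact: commute1.
have [rg rgE] := ext _ (cent_retractM ct g1).
have [rh rhE] := ext _ (cent_retractM ct h1).
have derK k (rho : {morphism [set: G] >-> G}) : k != 1 ->
    {in D, rho =1 cent_retract k} -> [set: G]^`(1) \subset 'ker rho.
  move=> k1 rhoE; rewrite /ker -sub_morphim_pre ?der_sub // morphim_der //.
  suff /derG1P-> : abelian (rho @* [set: G]) by [].
  rewrite -[X in rho @* X]genD morphim_gen ?finset.subsetT // abelian_gen; apply/centsP.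
  move=> _ /morphimP[x _ xD ->] _ /morphimP[y _ yD ->].
  by rewrite !rhoE //; exact: commute_cent_retract.
have g_fix : rg g = g by rewrite rgE // /cent_retract cent1id.
have h_fix : rh h = h by rewrite rhE // /cent_retract cent1id.
have h_die : rg h = 1.
  by rewrite rgE // /cent_retract; case: cent1P => // /commute_sym.
have hder : h \notin [set: G]^`(1).
  apply: contra (h1) => /(fintype.subsetP (derK _ _ h1 rhE)).
  by move=> /mker; rewrite h_fix => ->.
have kerT : 'ker rg = [set: G].
  case/maximal_eqP: maxG => _ /(_ ('ker rg)%G (derK _ _ g1 rgE)).
  case=> [|e|//]; first exact: finset.subsetT.
  by case/negP: hder; rewrite -e; apply/kerP; rewrite ?inE.
by case/eqP: g1; rewrite -g_fix; apply: mker; rewrite kerT inE.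
Qed.

End Obstruction.

(** The hypothesis on the derived subgroup says that the abelianization is trivial
    or of prime order. *)
Theorem dual_not_Frucht (R : realType) (G : finGroupType) :
  (~~ abelian [set: G])%g -> commutation_transitive G ->
  (maximal_eq [set: G]^`(1) [set: G])%g -> ~ Frucht (dual R G).
Proof.
move=> nab ct maxG /Frucht_dual_magic[N [X [w dw]]].
apply: (ct_generators_not_free nab ct maxG (degrees_gen dw)) => r rM.
exact: (degrees_extend dw rM).
Qed.

(** * Derived subgroups of 2-transitive groups *)

Section Derived.
Local Open Scope group_scope.
Variables (T : finType) (G : {group {perm T}}).

(** An abelian transitive permutation group is regular. *)
Lemma abelian_trans_card : 0 < #|T| ->
  abelian G -> [transitive G, on [set: T] | 'P] -> #|G| = #|T|.
Proof.
case/card_gt0P=> x _ abG trG; rewrite -cardsT.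
have [xG <-] := (card_orbit 'P G x, atransP trG x (finset.in_setT x)).
have stab1 : 'C_G[x | 'P] = 1.
  apply/trivgP; apply: fintype.subset_trans (aperm_faithful G).
  rewrite (astab_trans_gcore trG (finset.in_setT x)) finset.subsetI subsetIl.
  by rewrite gcore_max ?subsetIr ?(sub_abelian_norm abG) ?subsetIl.
by rewrite xG stab1 indexg1.
Qed.

(** A nontrivial normal subgroup of a primitive permutation group is transitive. *)
Lemma transitive2_dvd_derived : [transitive^2 G, on [set: T] | 'P] ->
  ~~ abelian G -> #|T| %| #|G^`(1)|.
Proof.
move=> tr2 nab; rewrite -cardsT.
have prG := ntransitive_primitive (ltnSn 1) tr2.
case: (prim_trans_norm prG (der_normal 1 G)) => [sub|]; last exact: atrans_dvd.
case/negP: nab; apply/derG1P/trivgP.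
by apply: fintype.subset_trans sub (aperm_faithful G).
Qed.

Lemma transitive2_nonabelian : [transitive^2 G, on [set: T] | 'P] ->
  0 < #|T| -> #|T| < #|G| -> ~~ abelian G.
Proof.
move=> tr2 T0 TG; apply/negP => abG.
by rewrite (abelian_trans_card T0 abG (ntransitive1 (ltn0Sn 1) tr2)) ltnn in TG.
Qed.

(** The derived subgroup has order at least #|T|, so its index is 1, 2 or 3. *)
Lemma maximal_derived_small : [transitive^2 G, on [set: T] | 'P] ->
  0 < #|T| -> #|T| < #|G| -> #|G| <= 3 * #|T| -> maximal_eq G^`(1) G.
Proof.
move=> tr2 T0 TG G3; have nab := transitive2_nonabelian tr2 T0 TG.
have /dvdn_leq := transitive2_dvd_derived tr2 nab.
move=> /(_ (cardG_gt0 _)) leT.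
have i3 : #|G : G^`(1)| <= 3.
  rewrite -divgS ?der_sub // leq_divLR ?cardSg ?der_sub //.
  by rewrite (leq_trans G3) // leq_mul2l.
have := indexg_gt0 G G^`(1); rewrite /maximal_eq.
case e : #|G : G^`(1)| i3 => [|[|[|[|]]]] // _ _.
- by rewrite finset.eqEsubset der_sub -indexg_eq1 e.
- by rewrite p_index_maximal ?orbT ?der_sub ?e.
- by rewrite p_index_maximal ?orbT ?der_sub ?e.
Qed.

End Derived.

Section Subgroups.
Local Open Scope group_scope.

Lemma maximal_eq_subg (gT : finGroupType) (G : {group gT}) :
  maximal_eq G^`(1) G -> maximal_eq [set: subg_of G]^`(1) [set: subg_of G].
Proof.
by rewrite -(im_subg G) -morphim_der // injm_maximal_eq ?injm_subg ?der_sub.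
Qed.

Lemma abelian_subg (gT : finGroupType) (G : {group gT}) :
  abelian [set: subg_of G] = abelian G.
Proof. by rewrite -(im_subg G) injm_abelian ?injm_subg. Qed.

Lemma simple_maximal_eq_derived (gT : finGroupType) (G : {group gT}) :
  simple G -> ~~ abelian G -> maximal_eq G^`(1) G.
Proof.
move=> /simpleP[_ sG] nab.
case: (sG _ (der_normal 1 G)) => [/derG1P abG|->]; first by rewrite abG in nab.
by rewrite /maximal_eq eqxx.
Qed.

End Subgroups.

Lemma Alt_trans2 (T : finType) : 3 < #|T| -> [transitive^2 'Alt_T, on [set: T] | 'P]%g.
Proof.
move=> lt3; apply: ntransitive_weak (Alt_trans T).
by case: #|T| lt3 => [|[|[|[]]]].
Qed.

Lemma card_Alt_ord n : 1 < n -> #|('Alt_('I_n))%g| = n`! %/ 2.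
Proof.
by move=> n1; have := @card_Alt 'I_n; rewrite card_ord => /(_ n1) <-; rewrite mulKn.
Qed.

(** * Commutation in permutation groups of small degree *)

Section SmallDegree.
Local Open Scope group_scope.

(** Permutations of {0, ..., n-1} as sequences of values, on which commutation in
    S_3, A_4 and A_5 can be decided by evaluation. *)
Definition perm_word n (s : 'S_n) : seq nat := [seq val (s i) | i <- enum 'I_n].

Definition word_mul (a b : seq nat) : seq nat := [seq nth 0%N b x | x <- a].

(** All permutations with their parities, by expansion along the value j taken at
    0: that value contributes the sign (-1)^j. *)
Fixpoint signed_words n : seq (bool * seq nat) :=
  if n is n'.+1 then
    [seq (odd j (+) p.1, j :: map (bump j) p.2) | j <- iota 0 n, p <- signed_words n']
  else [:: (false, [::])].

Lemma perm_word_inj n : injective (@perm_word n).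
Proof.
move=> s t /eq_in_map e; apply/permP => i; apply: val_inj.
by apply: e; rewrite mem_enum.
Qed.

Lemma perm_wordM n (s t : 'S_n) :
  perm_word (s * t) = word_mul (perm_word s) (perm_word t).
Proof.
rewrite /word_mul /perm_word -map_comp; apply: eq_map => i /=.
by rewrite permM (nth_map (s i)) ?size_enum_ord // nth_ord_enum.
Qed.

Lemma perm_word1 n : perm_word (1 : 'S_n) = iota 0 n.
Proof. by rewrite -val_enum_ord; apply: eq_map => i; rewrite perm1. Qed.

Lemma perm_lift n (s : 'S_n.+1) : exists t : 'S_n, s = lift_perm ord0 (s ord0) t.
Proof.
have ex i : exists j, s (lift ord0 i) = lift (s ord0) j.
  have : s ord0 != s (lift ord0 i) by rewrite (inj_eq perm_inj) neq_lift.
  by move/unlift_some=> [j -> _]; exists j.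
have [f fE] := choice ex.
have fI : injective f.
  by move=> i j e; apply/(@lift_inj _ ord0)/(@perm_inj _ s); rewrite !fE e.
exists (perm fI); apply/permP => i; case: (unliftP ord0 i) => [j|] ->.
  by rewrite lift_perm_lift fE permE.
by rewrite lift_perm_id.
Qed.

Lemma mem_signed_words n (s : 'S_n) :
  (odd_perm s, perm_word s) \in signed_words n.
Proof.
elim: n s => [|n IH] s.
  by rewrite permS0 odd_perm1 perm_word1.
have [t ->] := perm_lift s; set j := s ord0.
apply/allpairsP; exists (val j, (odd_perm t, perm_word t)); split.
- by rewrite mem_iota ltn_ord.
- exact: IH.
- rewrite odd_lift_perm /= /perm_word enum_ordSl /= lift_perm_id -!map_comp.
  congr (_, _ :: _); apply: eq_map => i /=.
  by rewrite lift_perm_lift.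
Qed.

Definition ct_words n (L : seq (seq nat)) :=
  all (fun y => (y == iota 0 n) ||
    let C := [seq x <- L | word_mul x y == word_mul y x] in
    all (fun x => all (fun z => word_mul x z == word_mul z x) C) C) L.

Lemma ct_perm n (P : pred bool) (x y z : 'S_n) :
  ct_words n [seq p.2 | p <- signed_words n & P p.1] ->
  P (odd_perm x) -> P (odd_perm y) -> P (odd_perm z) ->
  y != 1 -> commute x y -> commute y z -> commute x z.
Proof.
set L := [seq _ | _ <- _ & _] => ctL Px Py Pz y1 xy yz.
have inL (s : 'S_n) : P (odd_perm s) -> perm_word s \in L.
  move=> Ps; apply/mapP; exists (odd_perm s, perm_word s) => //.
  by rewrite mem_filter Ps mem_signed_words.
move/allP/(_ _ (inL _ Py)): ctL.
rewrite -perm_word1 (inj_eq (@perm_word_inj n)) (negPf y1) /=.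
move/allP/(_ (perm_word x)); rewrite mem_filter inL // andbT -!perm_wordM.
rewrite xy eqxx => /(_ isT).
move/allP/(_ (perm_word z)); rewrite mem_filter inL // andbT -!perm_wordM.
by rewrite yz eqxx => /(_ isT)/eqP/perm_word_inj.
Qed.

Lemma ct_S3 : commutation_transitive 'S_3.
Proof. by move=> x y z; apply: (@ct_perm 3 predT) => //; vm_compute. Qed.

Lemma ct_Alt n : ct_words n [seq p.2 | p <- signed_words n & ~~ p.1] ->
  commutation_transitive [subg 'Alt_('I_n)]%type.
Proof.
move=> ctn x y z y1 xy yz.
have even (s : [subg 'Alt_('I_n)]%type) : ~~ odd_perm (sgval s).
  by rewrite -Alt_even; exact: subgP.
have cE (s t : [subg 'Alt_('I_n)]%type) : commute s t <-> commute (sgval s) (sgval t).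
  rewrite /commute -!sgvalM ?inE //; split=> [->//|]; exact: val_inj.
apply/cE; apply: (ct_perm (P := negb) ctn (y := sgval y)) => //; try exact/cE.
Qed.

Lemma ct_Alt4 : commutation_transitive [subg 'Alt_('I_4)]%type.
Proof. by apply: ct_Alt; vm_compute. Qed.

Lemma ct_Alt5 : commutation_transitive [subg 'Alt_('I_5)]%type.
Proof. by apply: ct_Alt; vm_compute. Qed.

End SmallDegree.

(** * Non-Frucht duals *)

Theorem theorem6p5 (R : realType) :
  ~ Frucht (dual R 'S_3) /\
  ~ Frucht (dual R [subg 'Alt_('I_4)]) /\
  ~ Frucht (dual R [subg 'Alt_('I_5)]).
Proof.
split; [|split].
- have cS : #|[set: 'S_3]| = 6 by rewrite (card_Sym 'I_3) card_ord.
  have tr2 : [transitive^2 [set: 'S_3], on [set: 'I_3] | 'P]%g.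
    by apply: ntransitive_weak (Sym_trans 'I_3); rewrite card_ord.
  apply: dual_not_Frucht.
  + by apply: (transitive2_nonabelian tr2); rewrite card_ord ?cS.
  + exact: ct_S3.
  + by apply: (maximal_derived_small tr2); rewrite card_ord ?cS.
- have tr2 := @Alt_trans2 'I_4; rewrite card_ord in tr2.
  apply: dual_not_Frucht; rewrite ?abelian_subg.
  + by apply: (transitive2_nonabelian (tr2 isT)); rewrite card_ord ?card_Alt_ord.
  + exact: ct_Alt4.
  + apply/maximal_eq_subg.
    by apply: (maximal_derived_small (tr2 isT)); rewrite card_ord ?card_Alt_ord.
- have tr2 := @Alt_trans2 'I_5; rewrite card_ord in tr2.
  have nab : (~~ abelian 'Alt_('I_5))%g.
    by apply: (transitive2_nonabelian (tr2 isT)); rewrite card_ord ?card_Alt_ord.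
  apply: dual_not_Frucht; rewrite ?abelian_subg //; first exact: ct_Alt5.
  apply/maximal_eq_subg/simple_maximal_eq_derived => //.
  by apply: simple_Alt5; rewrite card_ord.
Qed.
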